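(* Let $\Delta=\Delta(X,Y,T,E)$ be an arbitrary tableau complex. Then: (1) $\Delta$ is pure, i.e. its facets (which are the tableaux $f\in T$) all have the same dimension; (2) the codimension of a face $F$ of $\Delta$ equals $\sum_{x\in X}(|F(x)|-1)$; in particular the faces of codimension $1$ (ridges) are the set-valued tableaux (faces) taking two values at exactly one $x\in X$ and one value at every other point of $X$; (3) each ridge is a face of at most two facets; in particular, if $\Delta$ is shellable then it is homeomorphic to a ball or a sphere; (4) the link of a face of $\Delta$ is again (isomorphic to) a tableau complex.
   Context: Let $X$ and $Y$ be finite sets. A tableau is a function $f:X\to Y$, identified with its graph $\{(x,f(x)):x\in X\}\subseteq X\times Y$. A set-valued tableau is a subset $F\subseteq X\times Y$; write $F(x)=\{y:(x,y)\in F\}$. For a tableau $f$, ''$f\subseteq F$'' means $f(x)\in F(x)$ for all $x$. Let $T$ be a set of tableaux and $E\subseteq X\times Y$ a subset containing (the graph of) every $f\in T$. For $(x,y)\in E$ put $v_{(x,y)}:=E\setminus\{(x,y)\}$. The tableau complex $\Delta(X,Y,T,E)$ is the simplicial complex on the ground set $\{v_{(x,y)}:(x,y)\in E\}$ whose faces are the sets $\{v_{(x,y)}:(x,y)\in E\setminus F\}$, where $F\subseteq E$ ranges over set-valued tableaux containing at least one $f\in T$; such a face is identified with $F$. Thus $F'$ is a face of $F$ iff $F'\supseteq F$, the facets are the tableaux $f\in T$, and $E$ is the empty face. The codimension of a face is the dimension of $\Delta$ minus the dimension of the face. The link of a face $C$ in a simplicial complex $\Delta$ is $\{D\in\Delta: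 D\cap C=\varnothing,\ D\cup C\in\Delta\}$. *)

(* Defs.v *)
From HB Require Import structures.
From mathcomp Require Import all_boot all_order all_algebra.
From mathcomp Require Import all_classical all_reals all_analysis.

Set Implicit Arguments.
Unset Strict Implicit.
Unset Printing Implicit Defensive.

Import Order.TTheory GRing.Theory Num.Theory.
Import numFieldNormedType.Exports.

(* Elements of [ground] need not be vertices: [[set v]] may fail to be a face.
   Both the void complex and the complex [set set0] are allowed. *)
Record scomplex (W : finType) := SComplex {
  ground : {set W};
  faces : {set {set W}};
  faces_ground : forall C : {set W}, C \in faces -> C \subset ground;
  faces_sub : forall C D : {set W}, C \in faces -> D \subset C -> D \in faces
}.

Section Complexes.
Variables (W : finType) (K : scomplex W).

Definition sdim (C : {set W}) : int := (#|C|%:Z - 1)%R.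

(* The void complex gets dimension -1 here. *)
Definition scdim : int := ((\max_(C in faces K) #|C|)%:Z - 1)%R.

Definition codim (C : {set W}) : int := (scdim - sdim C)%R.

Definition maximal_in (A : {set {set W}}) (C : {set W}) : bool :=
  (C \in A) && [forall D in A, (C \subset D) ==> (D == C)].

Definition facets : {set {set W}} := [set C | maximal_in (faces K) C].

Definition ridges : {set {set W}} := [set C in faces K | codim C == 1%R].

Definition pure : Prop :=
  forall C D : {set W}, C \in facets -> D \in facets -> sdim C = sdim D.

(* The faces common to the simplex on the facet C and to the subcomplex
   generated by the facets in s. *)
Definition attaching (s : seq {set W}) (C : {set W}) : {set {set W}} :=
  [set D in faces K | (D \subset C) && has (fun B : {set W} => D \subset B) s].

Definition is_shelling (s : seq {set W}) : Prop :=
  [/\ uniq s,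
      s =i facets
    & forall (s1 s2 : seq {set W}) (C : {set W}),
        s = s1 ++ C :: s2 -> s1 <> [::] ->
        forall D, maximal_in (attaching s1 C) D -> sdim D = (sdim C - 1)%R].

Definition shellable : Prop := pure /\ exists s, is_shelling s.

Definition link_faces (C : {set W}) : {set {set W}} :=
  [set D in faces K | [disjoint D & C] && (D :|: C \in faces K)].

Fact link_faces_ground (C D : {set W}) :
  D \in link_faces C -> D \subset ground K :\: C.
Proof.
by rewrite inE finset.subsetD => /and3P[/faces_ground -> -> _].
Qed.

Fact link_faces_sub (C D D' : {set W}) :
  D \in link_faces C -> D' \subset D -> D' \in link_faces C.
Proof.
rewrite !inE => /and3P[DK DC DCK] sD'.
rewrite (faces_sub DK sD') (disjointWl sD' DC) /=.
by apply: (faces_sub DCK); apply: finset.setSU.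
Qed.

Definition link (C : {set W}) : scomplex W :=
  SComplex (@link_faces_ground C) (@link_faces_sub C).

End Complexes.

Definition isomorphic (W W' : finType) (K : scomplex W) (K' : scomplex W') :=
  exists phi : W -> W',
    [/\ {in ground K &, injective phi},
        phi @: ground K = ground K'
      & [set phi @: C | C : {set W} in faces K] = faces K'].

Section TableauComplexes.
Variables (X Y : finType).

Definition graph (f : {ffun X -> Y}) : {set X * Y} := [set (x, f x) | x : X].

Definition sv_val (F : {set X * Y}) (x : X) : {set Y} := [set y | (x, y) \in F].

Definition tab_in (f : {ffun X -> Y}) (F : {set X * Y}) : bool :=
  [forall x, f x \in sv_val F x].

Variables (T : {set {ffun X -> Y}}) (E : {set X * Y}).

Definition sv_face (F : {set X * Y}) : bool :=
  (F \subset E) && [exists f in T, tab_in f F].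

Definition tvertex (p : X * Y) : {set X * Y} := E :\ p.

Definition face_of (F : {set X * Y}) : {set {set X * Y}} :=
  [set tvertex p | p in E :\: F].

Definition tc_ground : {set {set X * Y}} := [set tvertex p | p in E].

Definition tc_faces : {set {set {set X * Y}}} :=
  [set face_of F | F : {set X * Y} & sv_face F].

Fact tc_faces_ground (C : {set {set X * Y}}) : C \in tc_faces -> C \subset tc_ground.
Proof. by case/imsetP=> F _ ->; apply: imsetS; apply: finset.subsetDl. Qed.

Fact tc_faces_sub (C D : {set {set X * Y}}) :
  C \in tc_faces -> D \subset C -> D \in tc_faces.
Proof.
case/imsetP=> F; rewrite inE => /andP[FE /exists_inP[f fT /forallP fF]] -> DC.
apply/imsetP; exists [set p in E | tvertex p \notin D].
  rewrite inE; apply/andP; split; first by apply/fintype.subsetP=> p; rewrite inE => /andP[].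
  apply/exists_inP; exists f => //; apply/forallP=> x.
  have := fF x; rewrite !inE => xF; rewrite (fintype.subsetP FE _ xF) /=.
  apply/negP=> /(fintype.subsetP DC)/imsetP[q]; rewrite inE => /andP[qF qE] /setP eq_v.
  have := eq_v q; rewrite !inE eqxx qE andbT => /negbFE/eqP eq_q.
  by rewrite eq_q xF in qF.
apply/setP=> v; apply/idP/imsetP => [vD | [p]].
  have /imsetP[p] := fintype.subsetP DC _ vD; rewrite inE => /andP[_ pE] def_v.
  by exists p => //; rewrite !inE pE -def_v vD.
by rewrite !inE => /andP[+ pE] ->; rewrite pE /= negbK.
Qed.

Definition tableau_complex : scomplex {set X * Y} :=
  SComplex tc_faces_ground tc_faces_sub.

End TableauComplexes.

Definition iso_to_tableau_complex (W : finType) (K : scomplex W) : Prop :=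
  exists (X Y : finType) (T : {set {ffun X -> Y}}) (E : {set X * Y}),
    (forall f : {ffun X -> Y}, f \in T -> graph f \subset E) /\
    isomorphic K (tableau_complex T E).

Local Open Scope ring_scope.

(* Barycentric coordinates, indexed by W through [enum_rank]. *)
Definition realization (R : realType) (W : finType) (K : scomplex W)
    : set 'rV[R]_#|W| :=
  [set t : 'rV[R]_#|W| |
           [/\ forall i, 0 <= t ord0 i,
               \sum_i t ord0 i = 1
             & [set w : W | t ord0 (enum_rank w) != 0]%SET \in faces K]]%classic.
Arguments realization R {W} K.

(* Matrix types carry the sup norm, hence the explicit sums of squares. *)
Definition closed_unit_ball (R : realType) (n : nat) : set 'rV[R]_n :=
  [set x : 'rV[R]_n | \sum_i x ord0 i ^+ 2 <= 1]%classic.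
Arguments closed_unit_ball R n : clear implicits.

(* The (n-1)-sphere; it is empty for n = 0. *)
Definition unit_sphere (R : realType) (n : nat) : set 'rV[R]_n :=
  [set x : 'rV[R]_n | \sum_i x ord0 i ^+ 2 = 1]%classic.
Arguments unit_sphere R n : clear implicits.

(* Homeomorphism between the subspaces A of U and B of V; the values of f and g
   outside A and B are irrelevant. *)
Definition homeomorphic (U V : topologicalType) (A : set U) (B : set V) : Prop :=
  exists (f : U -> V) (g : V -> U),
    [/\ (forall x, A x -> B (f x)), (forall y, B y -> A (g y)),
        (forall x, A x -> g (f x) = x) & (forall y, B y -> f (g y) = y)] /\
    ({within A, continuous f} /\ {within B, continuous g})%classic.

Definition ball_or_sphere (R : realType) (W : finType) (K : scomplex W) : Prop :=
  exists n : nat,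
    homeomorphic (realization R K) (closed_unit_ball R n) \/
    homeomorphic (realization R K) (unit_sphere R n).

(* Main.v *)
(** A face [F] of the tableau complex has [#|E| - #|F|] vertices, and a tableau is
    a set-valued tableau of minimal size [#|X|]; this gives purity, the codimension
    formula and, since a ridge leaves a free choice between two values at a single
    point, the bound on the facets containing it. The link of [F] is the complex of
    the tableaux contained in [F].

    For a shellable complex whose ridges lie in at most two facets, one extends along
    the shelling a homeomorphism onto the unit ball that carries the boundary complex
    onto the sphere. Let the new facet [C] be attached along the ridges [C :\ a],
    [a \in A]. If [A] is not all of [C], collapsing [C] onto these ridges presents
    it as a collar over a part of the boundary, pinched exactly where the minimum of
    the coordinates outside [A] vanishes, and a ball with such a collar is mapped
    back to the ball by radial rescaling; no tameness of the attaching region is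
    needed. If [A = C], the boundary of [C] is the whole boundary of the ball and the
    result is a sphere, after which no facet can be added. Both cases rest on a
    combinatorial invariant: in the link of any face the boundary complex has no
    proper nonempty mod 2 cycle of ridges. *)

Require Import Defs.
From mathcomp Require Import all_boot all_order all_algebra.
From mathcomp Require Import all_classical all_reals all_analysis.
From mathcomp Require Import lra zify.

Set Implicit Arguments.
Unset Strict Implicit.
Unset Printing Implicit Defensive.

Import Order.TTheory GRing.Theory Num.Theory.
Import numFieldNormedType.Exports.

Local Open Scope ring_scope.

(** * Continuity on a subset *)

Section ContinuousOn.
Local Open Scope classical_set_scope.

(** Pointwise form of continuity in the subspace topology of [A], so that limit theorems for the
    filter [within A (nbhs x)] apply directly. *)
Definition cont_on (U V : topologicalType) (A : set U) (f : U -> V) :=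
  forall x, A x -> f @ within A (nbhs x) --> f x.

Lemma cont_on_id (U : topologicalType) (A : set U) : cont_on A id.
Proof. by move=> x _; apply: cvg_within. Qed.

Lemma cont_on_cst (U V : topologicalType) (A : set U) (c : V) :
  cont_on A (fun=> c).
Proof. by move=> x _; apply: cvg_cst. Qed.

Lemma continuous_cont_on (U V : topologicalType) (A : set U) (f : U -> V) :
  continuous f -> cont_on A f.
Proof. by move=> cf x _; apply: cvg_trans (cf x); apply: cvg_app; apply: cvg_within. Qed.

Lemma eq_cont_on (U V : topologicalType) (A : set U) (f g : U -> V) :
  (forall x, A x -> f x = g x) -> cont_on A f -> cont_on A g.
Proof.
move=> fg cf x Ax; rewrite -(fg _ Ax).
apply: cvg_trans (cf x Ax); apply: near_eq_cvg.
by rewrite near_withinE; near=> y => Ay; rewrite fg.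
Unshelve. all: by end_near. Qed.

Lemma cont_on_comp (U V Z : topologicalType) (A : set U) (B : set V)
    (f : U -> V) (g : V -> Z) :
  (forall x, A x -> B (f x)) -> cont_on A f -> cont_on B g ->
  cont_on A (fun x => g (f x)).
Proof.
move=> AB cf cg x Ax; apply: cvg_trans (cg _ (AB _ Ax)).
move=> P /= gP; rewrite /fmap /=.
have := cf x Ax _ gP; rewrite /fmap /= /within /=.
by apply: (@filterS _ (nbhs x)) => y yP Ay; apply: (yP Ay (AB _ Ay)).
Qed.

Lemma cont_on_sub (U V : topologicalType) (A B : set U) (f : U -> V) :
  A `<=` B -> cont_on B f -> cont_on A f.
Proof. by move=> AB; apply: (cont_on_comp (f := id) AB (@cont_on_id _ _)). Qed.

Variables (R : realType) (U : topologicalType) (A : set U).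
Implicit Types f g : U -> R.

Lemma cont_onD f g : cont_on A f -> cont_on A g -> cont_on A (fun x => f x + g x).
Proof. by move=> cf cg x Ax; apply: cvgD; [apply: cf|apply: cg]. Qed.

Lemma cont_onN f : cont_on A f -> cont_on A (fun x => - f x).
Proof. by move=> cf x Ax; apply: cvgN; apply: cf. Qed.

Lemma cont_onB f g : cont_on A f -> cont_on A g -> cont_on A (fun x => f x - g x).
Proof. by move=> cf cg; apply: cont_onD => //; apply: cont_onN. Qed.

Lemma cont_onM f g : cont_on A f -> cont_on A g -> cont_on A (fun x => f x * g x).
Proof. by move=> cf cg x Ax; apply: cvgM; [apply: cf|apply: cg]. Qed.

Lemma cont_onV f : (forall x, A x -> f x != 0) -> cont_on A f ->
  cont_on A (fun x => (f x)^-1).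
Proof. by move=> f0 cf x Ax; apply: cvgV; [apply: f0|apply: cf]. Qed.

Lemma cont_on_sqrt f : cont_on A f -> cont_on A (fun x => Num.sqrt (f x)).
Proof.
by move=> cf x Ax; apply: continuous_cvg; [apply: sqrt_continuous|apply: cf].
Qed.

Lemma cont_on_min f g : cont_on A f -> cont_on A g ->
  cont_on A (fun x => Num.min (f x) (g x)).
Proof.
move=> cf cg; apply: (@eq_cont_on _ _ _ (fun x => (f x + g x - `|f x - g x|) / 2)).
  by move=> x _; rewrite minr_absE.
apply: cont_onM (@cont_on_cst _ _ _ _).
apply: cont_onB; first exact: cont_onD.
by move=> x Ax; apply: cvg_norm; apply: cont_onB.
Qed.

Lemma cont_on_sum (I : Type) (r : seq I) (P : pred I) (F : I -> U -> R) :
  (forall i, P i -> cont_on A (F i)) -> cont_on A (fun x => \sum_(i <- r | P i) F i x).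
Proof.
move=> cF; elim: r => [|i r IH].
  by apply: (@eq_cont_on _ _ _ (fun=> 0)); [move=> x _; rewrite big_nil|apply: cont_on_cst].
case: (boolP (P i)) => Pi; last first.
  by apply: eq_cont_on IH => x _; rewrite big_cons (negbTE Pi).
apply: (@eq_cont_on _ _ _ (fun x => F i x + \sum_(i <- r | P i) F i x)).
  by move=> x _; rewrite big_cons Pi.
by apply: cont_onD => //; apply: cF.
Qed.

Lemma cont_on_bigmin (I : Type) (r : seq I) (P : pred I) (F : I -> U -> R) f :
  cont_on A f -> (forall i, P i -> cont_on A (F i)) ->
  cont_on A (fun x => \big[Num.min/f x]_(i <- r | P i) F i x).
Proof.
move=> cf cF; elim: r => [|i r IH].
  by apply: eq_cont_on cf => x _; rewrite big_nil.
case: (boolP (P i)) => Pi; last first.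
  by apply: eq_cont_on IH => x _; rewrite big_cons (negbTE Pi).
apply: (@eq_cont_on _ _ _ (fun x => Num.min (F i x) (\big[Num.min/f x]_(i <- r | P i) F i x))).
  by move=> x _; rewrite big_cons Pi.
by apply: cont_on_min => //; apply: cF.
Qed.

(* The product is continuous also where [f] is not, because there [r] vanishes
   and [f] stays bounded. *)
Lemma cont_on_mul_vanishing (M : R) (r f : U -> R) :
  cont_on A r -> (forall x, A x -> r x != 0 -> `|f x| <= M) ->
  cont_on [set x | A x /\ r x != 0] f -> cont_on A (fun x => r x * f x).
Proof.
move=> cr fM cf x Ax; have [r0|r0] := eqVneq (r x) 0.
  rewrite r0 mul0r; apply/cvgr0Pnorm_lt => e e0.
  have M0 : 0 <= `|M| by [].
  have eM : 0 < e / (`|M| + 1) by apply: divr_gt0 => //; lra.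
  have := cr x Ax; rewrite r0 => /cvgr0Pnorm_lt /(_ _ eM).
  rewrite !near_withinE; apply: filterS => y yP Ay; rewrite normrM.
  have [->|ry0] := eqVneq (r y) 0; first by rewrite normr0 mul0r.
  have /ltW ry := yP Ay; apply: le_lt_trans (ler_pM _ _ ry (fM y Ay ry0)) _ => //.
  rewrite mulrAC ltr_pdivrMr; last lra.
  by rewrite ltr_pM2l//; have := ler_norm M; lra.
apply: cvgM; first exact: cr.
have := cf x (conj Ax r0) => cfx P /= /cfx; rewrite /fmap /= /within /= !nbhs_simpl /=.
move=> H.
have : within A (nbhs x) (fun y => r y != 0).
  have := cr x Ax => /cvgr_neq0; exact.
rewrite /within /= => rn0.
by apply: filterS2 H rn0 => y yP yr Ay; apply: yP; split=> //; apply: yr.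
Qed.

End ContinuousOn.

(** * Continuity of row vectors *)

Section RowVectors.
Local Open Scope classical_set_scope.
Variables (R : realType).

Lemma cont_on_coord n (A : set 'rV[R]_n) i : cont_on A (fun t => t ord0 i).
Proof. by apply: continuous_cont_on; apply: coord_continuous. Qed.

Lemma cont_on_row (U : topologicalType) (A : set U) n (f : U -> 'rV[R]_n) :
  (forall i, cont_on A (fun x => f x ord0 i)) -> cont_on A f.
Proof.
move=> cf x Ax; apply/cvg_ballP => e e0.
have H : forall i, \forall y \near within A (nbhs x), ball (f x ord0 i) e (f y ord0 i).
  by move=> i; have /cvg_ballP := cf i x Ax; apply.
have : \forall y \near within A (nbhs x), forall i, ball (f x ord0 i) e (f y ord0 i).
  exact: filter_forall.
apply: filterS => y yP; split => // i j.
by rewrite (ord1 i); apply: yP.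
Qed.

End RowVectors.

(** A continuous bijection from a compact set to a Hausdorff space is a homeomorphism: closed
    subsets of [A] have compact, hence closed, images, and the complement of such an image is the
    neighbourhood sought. *)
Lemma compact_inverse (R : realType) (m n : nat) (A : set 'rV[R]_m) (B : set 'rV[R]_n)
    (f : 'rV[R]_m -> 'rV[R]_n) :
  compact A -> cont_on A f -> (forall x, A x -> B (f x)) ->
  (forall x x', A x -> A x' -> f x = f x' -> x = x') ->
  (forall y, B y -> exists2 x, A x & f x = y) ->
  exists g : 'rV[R]_n -> 'rV[R]_m,
    [/\ forall y, B y -> A (g y), forall x, A x -> g (f x) = x,
        forall y, B y -> f (g y) = y & cont_on B g].
Proof.
move=> cA cf AB finj fsurj.
have /choice[g gP] : forall y, exists x, B y -> A x /\ f x = y.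
  move=> y; have [By|nBy] := pselect (B y); last by exists 0.
  by have [x Ax fx] := fsurj y By; exists x.
exists g; split.
- by move=> y /gP[].
- by move=> x Ax; have [Ag fg] := gP _ (AB x Ax); apply: finj.
- by move=> y /gP[].
move=> y By O; rewrite nbhsE => -[Q [oQ Qgy] QO].
have cK : compact (A `&` ~` Q)%classic.
  by apply: compact_closedI => //; apply: open_closedC.
have clK : closed (f @` (A `&` ~` Q))%classic.
  apply: compact_closed; first exact: norm_hausdorff.
  apply: continuous_compact cK; apply/subspace_continuousP.
  by apply: cont_on_sub cf => x [].
have : nbhs y (~` (f @` (A `&` ~` Q)))%classic.
  apply: open_nbhs_nbhs; split; first exact: closed_openC.
  move=> [x [Ax nOx] fxy]; apply: nOx.
  have [Ag fg] := gP _ By.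
  by have -> : x = g y by apply: finj => //; rewrite fg.
rewrite /fmap /= /within /= !nbhs_simpl /=; apply: filterS => z zP Bz.
apply: QO; apply: contrapT => nO; apply: zP.
by have [Ag fg] := gP _ Bz; exists (g z).
Qed.

(** * Geometric simplicial complexes and ball charts *)

Section Euclid.
Variable R : realType.

Definition enorm n (x : 'rV[R]_n) : R := Num.sqrt (\sum_i x ord0 i ^+ 2).

Lemma sum_sqr_ge0 n (x : 'rV[R]_n) : 0 <= \sum_i x ord0 i ^+ 2.
Proof. by apply: sumr_ge0 => i _; rewrite sqr_ge0. Qed.

Lemma enorm_ge0 n (x : 'rV[R]_n) : 0 <= enorm x.
Proof. exact: sqrtr_ge0. Qed.

Lemma sqr_enorm n (x : 'rV[R]_n) : enorm x ^+ 2 = \sum_i x ord0 i ^+ 2.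
Proof. by rewrite sqr_sqrtr ?sum_sqr_ge0. Qed.

Lemma enormZ n (a : R) (x : 'rV[R]_n) : 0 <= a -> enorm (a *: x) = a * enorm x.
Proof.
move=> a0; rewrite /enorm.
under eq_bigr => i _ do rewrite mxE exprMn.
by rewrite -mulr_sumr sqrtrM ?sqr_ge0// sqrtr_sqr ger0_norm.
Qed.

Lemma enorm0 n : enorm (0 : 'rV[R]_n) = 0.
Proof. by rewrite -(scale0r 0) enormZ// mul0r. Qed.

Lemma enorm_eq0 n (x : 'rV[R]_n) : enorm x = 0 -> x = 0.
Proof.
move=> x0; apply/rowP => i; rewrite mxE; apply/eqP; rewrite -sqrf_eq0; apply/eqP.
have := sqr_enorm x; rewrite x0 expr0n /= => /esym/eqP.
by rewrite psumr_eq0 => [/allP/(_ i)|j _]; [rewrite mem_index_enum => /(_ isT)/eqP|rewrite sqr_ge0].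
Qed.

Lemma enorm_gt0 n (x : 'rV[R]_n) : x != 0 -> 0 < enorm x.
Proof. by rewrite lt_def enorm_ge0 andbT; apply: contraNneq => /enorm_eq0 ->. Qed.

Lemma le_coord_enorm n (x : 'rV[R]_n) i : `|x ord0 i| <= enorm x.
Proof.
rewrite -(@ler_pXn2r _ 2) ?nnegrE ?enorm_ge0// sqr_enorm real_normK ?num_real//.
by rewrite (bigD1 i)//= lerDl sumr_ge0// => j _; rewrite sqr_ge0.
Qed.

Lemma cont_on_enorm n (A : set 'rV[R]_n) : cont_on A (@enorm n).
Proof.
apply: cont_on_sqrt; apply: cont_on_sum => i _.
by apply: cont_onM; apply: cont_on_coord.
Qed.

Lemma closed_unit_ballE n (x : 'rV[R]_n) : closed_unit_ball R n x <-> enorm x <= 1.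
Proof.
rewrite /closed_unit_ball /= -sqr_enorm -[X in _ <= X](expr1n R 2).
by rewrite ler_pXn2r ?nnegrE ?enorm_ge0.
Qed.

Lemma unit_sphereE n (x : 'rV[R]_n) : unit_sphere R n x <-> enorm x = 1.
Proof.
rewrite /unit_sphere /= -sqr_enorm; split=> [/eqP|->]; last by rewrite expr1n.
by rewrite sqrp_eq1 ?enorm_ge0// => /eqP.
Qed.

(** As [0^-1 = 0], the zero vector is sent to itself, so the image lies in the closed unit ball
    without a side condition. *)
Definition normalize n (x : 'rV[R]_n) := (enorm x)^-1 *: x.

Lemma enorm_normalize n (x : 'rV[R]_n) : x != 0 -> enorm (normalize x) = 1.
Proof.
by move=> /enorm_gt0 x0; rewrite enormZ ?invr_ge0 ?ltW// mulVf// gt_eqF.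
Qed.

Lemma enorm_normalize_le1 n (x : 'rV[R]_n) : enorm (normalize x) <= 1.
Proof.
have [->|x0] := eqVneq x 0; last by rewrite enorm_normalize.
by rewrite /normalize scaler0 enorm0.
Qed.

Lemma normalizeZ n (a : R) (x : 'rV[R]_n) : 0 < a -> normalize (a *: x) = normalize x.
Proof.
move=> a0; rewrite /normalize enormZ ?ltW// scalerA invfM mulrAC mulVf ?mul1r//.
by rewrite gt_eqF.
Qed.

Lemma normalize_id n (x : 'rV[R]_n) : enorm x = 1 -> normalize x = x.
Proof. by move=> x1; rewrite /normalize x1 invr1 scale1r. Qed.

Lemma normalizeK n (x : 'rV[R]_n) : enorm x *: normalize x = x.
Proof.
have [->|x0] := eqVneq x 0; first by rewrite /normalize !scaler0.
by rewrite scalerA divff ?scale1r// gt_eqF// enorm_gt0.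
Qed.

Lemma cont_on_normalize n (A : set 'rV[R]_n) :
  (forall x, A x -> x != 0) -> cont_on A (@normalize n).
Proof.
move=> A0; apply: cont_on_row => i.
apply: (@eq_cont_on _ _ _ (fun x => (enorm x)^-1 * x ord0 i)).
  by move=> x _; rewrite mxE.
apply: cont_onM; last exact: cont_on_coord.
apply: cont_onV; last exact: cont_on_enorm.
by move=> x /A0/enorm_gt0; apply: lt0r_neq0.
Qed.

End Euclid.

Lemma sum_mem (R : realType) (W : finType) (D : {set W}) :
  \sum_w (w \in D)%:R = #|D|%:R :> R.
Proof.
by rewrite -sum1_card natr_sum [RHS]big_mkcond; apply: eq_bigr => w _; case: (w \in D).
Qed.

(** * Unions of simplices in barycentric coordinates *)

Section Geometric.
Variables (R : realType) (W : finType).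
Local Notation V := 'rV[R]_#|W|.
Implicit Types (t s : V) (S : {set {set W}}) (A B C : {set W}).

Definition bary t w : R := t ord0 (enum_rank w).
Definition of_bary (p : W -> R) : V := \row_i p (enum_val i).

Lemma of_baryE p w : bary (of_bary p) w = p w.
Proof. by rewrite /bary mxE enum_rankK. Qed.

Lemma bary_inj t s : bary t =1 bary s -> t = s.
Proof. by move=> ts; apply/rowP => i; have := ts (enum_val i); rewrite /bary enum_valK. Qed.

Lemma sum_bary t : \sum_i t ord0 i = \sum_w bary t w.
Proof. by rewrite (reindex enum_rank) //=; apply: onW_bij; apply: enum_rank_bij. Qed.

Lemma cont_on_bary (A : set V) w : cont_on A (fun t => bary t w).
Proof. exact: cont_on_coord. Qed.

Lemma cont_on_of_bary (U : topologicalType) (A : set U) (p : U -> W -> R) :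
  (forall w, cont_on A (fun x => p x w)) -> cont_on A (fun x => of_bary (p x)).
Proof.
move=> cp; apply: cont_on_row => i.
by apply: eq_cont_on (cp (enum_val i)) => x _; rewrite mxE.
Qed.

Definition in_simplex C t := [/\ forall w, 0 <= bary t w, \sum_w bary t w = 1
  & forall w, w \notin C -> bary t w = 0].

(** The family [S] need not be closed under subsets: it may list only facets, or only the ridges of
    a boundary. *)
Definition geo S : set V := [set t | exists2 B, B \in S & in_simplex B t]%classic.

Lemma in_simplexS C B t : C \subset B -> in_simplex C t -> in_simplex B t.
Proof.
move=> CB [t0 t1 tC]; split=> // w wB; apply: tC.
by apply: contra wB; apply: (fintype.subsetP CB).
Qed.

Lemma bary_le1 C t w : in_simplex C t -> bary t w <= 1.
Proof. by case=> t0 <- _; rewrite (bigD1 w)//= lerDl sumr_ge0. Qed.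

Lemma closed_in_simplex C : closed [set t | in_simplex C t].
Proof.
have cb w : continuous (fun t => bary t w) by apply: coord_continuous.
have -> : [set t | in_simplex C t]%classic =
    ((\bigcap_(w in setT) [set t | 0 <= bary t w]) `&` [set t | \sum_w bary t w = 1] `&`
     (\bigcap_(w in [set w | w \notin C]) [set t | bary t w = 0]))%classic.
  apply/classical_sets.seteqP; split=> [t [t0 t1 tC]|t [[t0 t1] tC]].
    by split; [split=> // w _; apply: t0|move=> w; apply: tC].
  by split=> // w; apply: t0.
apply: closedI; first apply: closedI.
- apply: closed_bigI => w _; apply: (@preimage_closed _ _ (fun t => bary t w) [set x | 0 <= x]%classic).
    by move=> t _; apply: cb.
  exact: closed_ge.
- apply: (@preimage_closed _ _ (fun t => \sum_w bary t w) [set x | x = 1]%classic); last exact: closed_eq.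
  move=> t _; have : cont_on setT (fun t => \sum_w bary t w).
    by apply: cont_on_sum => w _; apply: cont_on_bary.
  by move=> /(_ t I); rewrite withinET.
- apply: closed_bigI => w _; apply: (@preimage_closed _ _ (fun t => bary t w) [set x | x = 0]%classic).
    by move=> t _; apply: cb.
  exact: closed_eq.
Qed.

Lemma compact_geo S : compact (geo S).
Proof.
apply: (@subclosed_compact _ _ [set t : V | forall i, `[0, 1]%classic (t ord0 i)]%classic).
- have -> : geo S = (\bigcup_(C in [set` S]) [set t | in_simplex C t])%classic.
    by apply/classical_sets.seteqP; split=> t [B BS tB]; exists B.
  apply: closed_bigcup => [|C _]; [exact: finite_finpred|exact: closed_in_simplex].
- apply: (@rV_compact R #|W| (fun=> `[0, 1]%classic)) => _; apply: segment_compact.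
move=> t [B _ tB] i /=; rewrite in_itv /=.
have := bary_le1 (enum_val i) tB; have [/(_ (enum_val i))] := tB.
by rewrite /bary enum_valK => -> _ _ ->.
Qed.

Section Min.
Variables (a0 : W) (A : {set W}).
Hypothesis a0A : a0 \in A.

(** The minimum has no neutral element in [R]; the seed [p a0] is harmless because [a0] lies in
    [A]. *)
Definition bmin (p : W -> R) : R := \big[Num.min/p a0]_(a in A) p a.

Lemma bmin_le p a : a \in A -> bmin p <= p a.
Proof. by move=> aA; apply: bigmin_le_cond. Qed.

Lemma bmin_attained p : exists2 a, a \in A & p a = bmin p.
Proof.
rewrite /bmin; apply: (big_ind (fun x => exists2 a, a \in A & p a = x)).
- by exists a0.
- move=> _ _ [a aA <-] [b bA <-].
  by case: (leP (p a) (p b)) => _; [exists a|exists b].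
- by move=> a aA; exists a.
Qed.

Lemma bmin_unique p x : (forall a, a \in A -> x <= p a) ->
  (exists2 a, a \in A & p a = x) -> bmin p = x.
Proof.
move=> xp [a aA pa]; apply/eqP; rewrite eq_le -{1}pa bmin_le//=.
by have [b bA <-] := bmin_attained p; apply: xp.
Qed.

Lemma bmin_shift p (c : R) : bmin (fun w => p w + c) = bmin p + c.
Proof.
apply: bmin_unique; first by move=> a aA; rewrite lerD2r bmin_le.
by have [b bA <-] := bmin_attained p; exists b.
Qed.

Lemma eq_bmin p p' : {in A, p =1 p'} -> bmin p = bmin p'.
Proof.
move=> pp'; apply: bmin_unique; first by move=> a aA; rewrite pp'// bmin_le.
by have [b bA <-] := bmin_attained p'; exists b; rewrite ?pp'.
Qed.

Lemma cont_on_bmin (D : set V) : cont_on D (fun t => bmin (bary t)).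
Proof. by apply: cont_on_bigmin => [|i _]; apply: cont_on_bary. Qed.

End Min.

Record ball_chart n S (bd : {set {set W}}) (f : V -> 'rV[R]_n) (g : 'rV[R]_n -> V) :
    Prop := BallChart {
  chart_le1 : forall t, geo S t -> enorm (f t) <= 1;
  chart_inv : forall x, enorm x <= 1 -> geo S (g x);
  chartK : forall t, geo S t -> g (f t) = t;
  chart_invK : forall x, enorm x <= 1 -> f (g x) = x;
  cont_chart : cont_on (geo S) f;
  cont_chart_inv : cont_on [set x | enorm x <= 1]%classic g;
  chart_bd : forall t, geo S t -> (enorm (f t) = 1 <-> geo bd t) }.

Lemma ball_chart_of_bij n S bd (f : V -> 'rV[R]_n) :
  cont_on (geo S) f -> (forall t, geo S t -> enorm (f t) <= 1) ->
  (forall t t', geo S t -> geo S t' -> f t = f t' -> t = t') ->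
  (forall x, enorm x <= 1 -> exists2 t, geo S t & f t = x) ->
  (forall t, geo S t -> (enorm (f t) = 1 <-> geo bd t)) ->
  exists g, ball_chart S bd f g.
Proof.
move=> cf f1 finj fsurj fbd.
have [g [g1 g2 g3 g4]] := compact_inverse (B := [set x | enorm x <= 1]%classic)
  (@compact_geo S) cf f1 finj fsurj.
by exists g.
Qed.

End Geometric.

(** * Attaching a simplex along part of its boundary *)

Section BallStep.
Variables (R : realType) (W : finType) (n : nat).
Variables (S bd bd' : {set {set W}}) (C A : {set W}) (a0 b0 : W).
Variables (f : 'rV[R]_#|W| -> 'rV[R]_n) (g : 'rV[R]_n -> 'rV[R]_#|W|).
Local Notation V := 'rV[R]_#|W|.
Local Notation B := (C :\: A).
Implicit Types (t s : V) (D : {set W}).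

Hypothesis chart : ball_chart S bd f g.
Hypothesis a0A : a0 \in A.
Hypothesis b0B : b0 \in B.
Hypothesis AC : A \subset C.
(** With [bd_faces] and [bd_attach], this makes [A] the smallest new face of [C]: a face of [C] lies
    in an old simplex exactly when it misses a vertex of [A]. *)
Hypothesis A_new : forall D, D \in S -> ~~ (A \subset D).
Hypothesis bd_faces : forall P, P \in bd -> exists2 D, D \in S & P \subset D.
Hypothesis bd_attach : forall a, a \in A -> C :\ a \in bd.
Hypothesis bd_star : forall P, P \in bd -> B \subset P -> exists2 a, a \in A & P = C :\ a.
Hypothesis bd'P : forall P, P \in bd' <->
  (P \in bd /\ ~ exists2 a, a \in A & P = C :\ a) \/ exists2 b, b \in B & P = C :\ b.

(** Makes the direction used in [shift], [1] on [A] and [- q^-1] on [B], have coordinate sum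
    [#|A| - q^-1 * #|B| = 0]. *)
Let q : R := #|B|%:R / #|A|%:R.

Let cA_gt0 : 0 < #|A|%:R :> R.
Proof. by rewrite ltr0n; apply/card_gt0P; exists a0. Qed.

Let cB_gt0 : 0 < #|B|%:R :> R.
Proof. by rewrite ltr0n; apply/card_gt0P; exists b0. Qed.

Let q_gt0 : 0 < q. Proof. exact: divr_gt0. Qed.

(** [height] is the parameter by which [collapse] moves a point, and it vanishes on the old complex.
    [depth] bounds the collar: a point of [C] of height 0 can be lifted by [u >= 0] within [C]
    exactly when [u <= q * depth]. *)
Definition height (t : V) := bmin a0 A (bary t).
Definition depth (t : V) := bmin b0 B (bary t).

(* The points of the line through [t] along which the simplex [C] is collapsed
   onto its faces [C :\ a], [a \in A]. *)
Definition shift (t : V) (u : R) : V :=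
  of_bary (fun w => bary t w + u * ((w \in A)%:R - q^-1 * (w \in B)%:R)).

Definition collapse (t : V) := shift t (- height t).

Lemma bary_shift t u w :
  bary (shift t u) w = bary t w + u * ((w \in A)%:R - q^-1 * (w \in B)%:R).
Proof. exact: of_baryE. Qed.

Lemma shiftD t u v : shift (shift t u) v = shift t (u + v).
Proof. by apply: bary_inj => w; rewrite !bary_shift -addrA -mulrDl. Qed.

Lemma shift0 t : shift t 0 = t.
Proof. by apply: bary_inj => w; rewrite bary_shift mul0r addr0. Qed.

Lemma bary_shiftA t u w : w \in A -> bary (shift t u) w = bary t w + u.
Proof. by move=> wA; rewrite bary_shift inE wA /= mulr0 subr0 mulr1. Qed.

Lemma bary_shiftB t u w : w \in B -> bary (shift t u) w = bary t w - u / q.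
Proof.
move=> wB; rewrite bary_shift wB; move: wB; rewrite inE => /andP[/negbTE-> _].
by rewrite mulr1 sub0r mulrN.
Qed.

Lemma bary_shiftN t u w : w \notin C -> bary (shift t u) w = bary t w.
Proof.
move=> wC; rewrite bary_shift inE (negbTE wC) andbF.
by rewrite (contraNF (fintype.subsetP AC w) wC) mulr0 subr0 mulr0 addr0.
Qed.

Lemma sum_shift t u : \sum_w bary (shift t u) w = \sum_w bary t w.
Proof.
under eq_bigr => w _ do rewrite bary_shift.
rewrite big_split /= -mulr_sumr sumrB -mulr_sumr !sum_mem.
by rewrite /q invf_div divfK ?gt_eqF// subrr mulr0 addr0.
Qed.

Lemma height_shift t u : height (shift t u) = height t + u.
Proof.
rewrite /height -bmin_shift//; apply: eq_bmin => // w wA.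
by rewrite bary_shiftA.
Qed.

Lemma depth_shift t u : depth (shift t u) = depth t - u / q.
Proof.
rewrite /depth -bmin_shift//; apply: eq_bmin => // w wB.
by rewrite bary_shiftB.
Qed.

Lemma height_ge0 D t : in_simplex D t -> 0 <= height t.
Proof. by case=> t0 _ _; rewrite /height; have [a _ <-] := bmin_attained a0A (bary t). Qed.

Lemma depth_ge0 D t : in_simplex D t -> 0 <= depth t.
Proof. by case=> t0 _ _; rewrite /depth; have [a _ <-] := bmin_attained b0B (bary t). Qed.

Lemma height_le1 D t : in_simplex D t -> height t <= 1.
Proof. by move=> tD; apply: le_trans (bary_le1 a0 tD); apply: bmin_le. Qed.

Lemma geo_height0 t : geo S t -> height t = 0.
Proof.
move=> [D DS tD]; apply/eqP; rewrite eq_le (height_ge0 tD) andbT.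
have /fintype.subsetPn[a aA aD] := A_new DS.
by have [_ _ /(_ a aD)<-] := tD; apply: bmin_le.
Qed.

Lemma collapse_id t : geo S t -> collapse t = t.
Proof. by move=> /geo_height0 t0; rewrite /collapse t0 oppr0 shift0. Qed.

Lemma collapseK t : shift (collapse t) (height t) = t.
Proof. by rewrite /collapse shiftD addNr shift0. Qed.

Lemma geo_bdW t : geo bd t -> geo S t.
Proof.
by move=> [P /bd_faces[D DS PD] tP]; exists D => //; apply: in_simplexS tP.
Qed.

(** Subtracting the minimum over [A] makes some coordinate [a] in [A] vanish while the coordinates
    in [B] do not decrease, so the image lies in the face [C :\ a]. *)
Lemma collapse_simplex t : in_simplex C t -> geo bd (collapse t).
Proof.
move=> tC; have h0 := height_ge0 tC; have [t0 t1 tNC] := tC.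
have [a aA ta] := bmin_attained a0A (bary t).
exists (C :\ a); first exact: bd_attach.
split; last 1 first.
- move=> w; rewrite !inE negb_and negbK => /orP[/eqP ->|wC].
    by rewrite bary_shiftA// ta subrr.
  by rewrite bary_shiftN// tNC.
- move=> w; have [wC|wC] := boolP (w \in C); last by rewrite bary_shiftN.
  have [wA|wA] := boolP (w \in A); first by rewrite bary_shiftA// subr_ge0 bmin_le.
  rewrite bary_shiftB; last by rewrite inE wA.
  by rewrite mulNr opprK addr_ge0// divr_ge0// ltW.
- by rewrite sum_shift.
Qed.

Lemma geo_addP t : geo (C |: S) t -> in_simplex C t \/ geo S t.
Proof.
by move=> [D]; rewrite !inE => /orP[/eqP -> | DS] tD; [left|right; exists D].
Qed.

Lemma geo_add_simplex t : geo (C |: S) t -> exists D, in_simplex D t.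
Proof. by case=> D _; exists D. Qed.

Lemma geo_addl t : in_simplex C t -> geo (C |: S) t.
Proof. by exists C => //; rewrite setU11. Qed.

Lemma geo_addr t : geo S t -> geo (C |: S) t.
Proof. by case=> D DS tD; exists D => //; rewrite inE DS orbT. Qed.

Lemma geo_collapse t : geo (C |: S) t -> geo S (collapse t).
Proof.
by move=> /geo_addP[/collapse_simplex/geo_bdW//|tS]; rewrite collapse_id.
Qed.

Lemma collapse_bd t : geo (C |: S) t -> 0 < height t -> geo bd (collapse t).
Proof.
by move=> /geo_addP[/collapse_simplex//|tS]; rewrite (geo_height0 tS) ltxx.
Qed.

Lemma depth0_face t : in_simplex C t -> depth t = 0 -> geo bd' t.
Proof.
move=> [t0 t1 tC] dt; have [b bB tb] := bmin_attained b0B (bary t).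
exists (C :\ b); first by apply/bd'P; right; exists b.
split=> // w; rewrite !inE negb_and negbK => /orP[/eqP ->|/tC//].
by rewrite tb.
Qed.

Lemma depth_missing D t b : b \in B -> b \notin D -> in_simplex D t -> depth t = 0.
Proof.
move=> bB bD tD; apply/eqP; rewrite eq_le (depth_ge0 tD) andbT.
by have [_ _ /(_ b bD)<-] := tD; apply: bmin_le.
Qed.

(** A surviving ridge of the old boundary omits a vertex of [B] by [bd_star], so [depth] vanishes on
    it. Conversely, a point of [C] of depth 0 lies in some [C :\ b]. *)
Lemma geo_bd'P t : geo (C |: S) t ->
  geo bd' t <-> geo bd (collapse t) /\ depth t = 0.
Proof.
move=> tS'; split=> [[P /bd'P[[Pbd Pn]|[b bB ->]] tP]|[ct dt]].
- have tbd : geo bd t by exists P.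
  have tS := geo_bdW tbd.
  rewrite collapse_id//; split=> //.
  have [BP|/fintype.subsetPn[b bB bP]] := boolP (B \subset P).
    by case: Pn; apply: bd_star.
  exact: (depth_missing bB bP tP).
- split; last by apply: (depth_missing bB _ tP); rewrite !inE eqxx.
  by apply: collapse_simplex; apply: in_simplexS tP; apply: finset.subD1set.
have [tC|tS] := geo_addP tS'; first exact: depth0_face.
move: ct; rewrite collapse_id// => -[P Pbd tP].
have [[a aA Pa]|Pn] := pselect (exists2 a, a \in A & P = C :\ a).
  apply: depth0_face => //; apply: in_simplexS tP; rewrite Pa; exact: finset.subD1set.
by exists P => //; apply/bd'P; left.
Qed.

(** Placing the collar point of height [h] over [s] at [(1 + h) *: f s] extends the ball to a
    star-shaped set; as [h] ranges up to [q * depth s], its boundary in the direction of [x] is at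
    distance [radius x]. *)
Definition radius (x : 'rV[R]_n) : R := 1 + q * depth (g (normalize x)).

Lemma radius_ge1 x : 1 <= radius x.
Proof.
have [D _ gD] := chart_inv chart (enorm_normalize_le1 x).
by rewrite /radius lerDl; apply: mulr_ge0; [apply: ltW|apply: depth_ge0 gD].
Qed.

Lemma radius_gt0 x : 0 < radius x.
Proof. exact: lt_le_trans (radius_ge1 x). Qed.

Lemma radius_bd t : geo bd t -> radius (f t) = 1 + q * depth t.
Proof.
move=> tbd; have tS := geo_bdW tbd; have /(chart_bd chart tS) f1 := tbd.
by rewrite /radius normalize_id// (chartK chart).
Qed.

(** The extended ball is shrunk back to the unit ball along rays. *)
Definition new_chart t : 'rV[R]_n :=
  ((1 + height t) / radius (f (collapse t))) *: f (collapse t).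

Lemma radius_collapse t : geo bd (collapse t) ->
  radius (f (collapse t)) = 1 + height t + q * depth t.
Proof.
move=> ct; rewrite radius_bd// depth_shift mulNr opprK mulrDr.
by rewrite mulrCA divff ?gt_eqF// mulr1 -addrA [X in 1 + X]addrC.
Qed.

Lemma scale_gt0 t : geo (C |: S) t -> 0 < (1 + height t) / radius (f (collapse t)).
Proof.
move=> /geo_add_simplex[D tD]; rewrite divr_gt0 ?radius_gt0//.
by have := height_ge0 tD; lra.
Qed.

Lemma enorm_new t : geo (C |: S) t -> enorm (new_chart t) =
  (1 + height t) / radius (f (collapse t)) * enorm (f (collapse t)).
Proof. by move=> tS'; rewrite enormZ// ltW// scale_gt0. Qed.

Lemma inner_height0 t : geo (C |: S) t -> enorm (f (collapse t)) < 1 -> height t = 0.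
Proof.
move=> tS' lt1; have [D tD] := geo_add_simplex tS'.
apply/eqP; apply: contraTT lt1 => h0; rewrite -leNgt.
have /(chart_bd chart (geo_collapse tS'))-> // : geo bd (collapse t).
by apply: collapse_bd => //; rewrite lt_def h0 (height_ge0 tD).
Qed.

(** Over the old boundary the norm is [(1 + h) / (1 + h + q * d)], with [h] the height and [d] the
    depth, so it is 1 exactly when [d = 0]. Elsewhere the height is 0 and the norm is less than
    1. *)
Lemma new_chart_spec t : geo (C |: S) t ->
  enorm (new_chart t) <= 1 /\ (enorm (new_chart t) = 1 <-> geo bd' t).
Proof.
move=> tS'; have cS := geo_collapse tS'; have [D tD] := geo_add_simplex tS'.
rewrite enorm_new//; have r0 := radius_gt0 (f (collapse t)).
have d0 := depth_ge0 tD; have h0 := height_ge0 tD.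
have [/(chart_bd chart cS) ct|lt1] := eqVneq (enorm (f (collapse t))) 1.
  have /(chart_bd chart cS) -> := ct; rewrite mulr1 radius_collapse//.
  have qd : 0 <= q * depth t by apply: mulr_ge0 => //; apply: ltW.
  have den : 0 < 1 + height t + q * depth t by lra.
  rewrite ler_pdivrMr// mul1r lerDl; split=> //.
  rewrite (geo_bd'P tS'); split=> [|[_ ->]]; last first.
    by rewrite mulr0 addr0 divff//; apply: lt0r_neq0; lra.
  move=> /(canRL (divfK (lt0r_neq0 den))); rewrite mul1r => e; split=> //; apply/eqP.
  have : q * depth t = 0 by lra.
  by move=> /eqP; rewrite mulf_eq0 (gt_eqF q_gt0).
have {}lt1 : enorm (f (collapse t)) < 1.
  by rewrite lt_neqAle lt1 (chart_le1 chart).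
rewrite (inner_height0 tS' lt1) addr0 mul1r.
have lt1' : (radius (f (collapse t)))^-1 * enorm (f (collapse t)) < 1.
  by rewrite mulrC ltr_pdivrMr// mul1r (lt_le_trans lt1)// radius_ge1.
split; first exact: ltW.
split=> [e|/(geo_bd'P tS')[/(chart_bd chart cS) e]]; first by rewrite e ltxx in lt1'.
by rewrite e ltxx in lt1.
Qed.

(** The direction of the image determines the radius, so the norm determines
    [(1 + height t) * enorm (f (collapse t))]. The height is 0 unless the second factor is 1, hence
    the product determines both factors. *)
Lemma new_chart_inj t t' : geo (C |: S) t -> geo (C |: S) t' ->
  new_chart t = new_chart t' -> t = t'.
Proof.
move=> tS tS' e; have [D tD] := geo_add_simplex tS; have [D' tD'] := geo_add_simplex tS'.
have en : normalize (f (collapse t)) = normalize (f (collapse t')).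
  by rewrite -(normalizeZ _ (scale_gt0 tS)) -/(new_chart t) e normalizeZ ?scale_gt0.
have er : radius (f (collapse t)) = radius (f (collapse t')) by rewrite /radius en.
have := congr1 (@enorm R n) e; rewrite !enorm_new// -er.
rewrite ![_ / _ * _]mulrAC => /(mulIf _) eh.
have {eh} : (1 + height t) * enorm (f (collapse t)) =
    (1 + height t') * enorm (f (collapse t')).
  by apply: eh; rewrite invr_neq0// gt_eqF// radius_gt0.
have h0 := height_ge0 tD; have h0' := height_ge0 tD'.
have := chart_le1 chart (geo_collapse tS); have := chart_le1 chart (geo_collapse tS').
have i := inner_height0 tS; have i' := inner_height0 tS'.
have n0 := enorm_ge0 (f (collapse t)); have n0' := enorm_ge0 (f (collapse t')).
move=> le1' le1 eh.
have [eqh eqe] : height t = height t' /\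
    enorm (f (collapse t)) = enorm (f (collapse t')).
  have [l|l] := ltP (enorm (f (collapse t))) 1;
  have [l'|l'] := ltP (enorm (f (collapse t'))) 1.
  - by move: eh; rewrite i// i'// addr0 !mul1r.
  - by move: eh; rewrite i//; nra.
  - by move: eh; rewrite i'//; nra.
  - have e1 : enorm (f (collapse t)) = 1 by lra.
    have e1' : enorm (f (collapse t')) = 1 by lra.
    by move: eh; rewrite e1 e1'; split=> //; lra.
have ec : collapse t = collapse t'.
  rewrite -(chartK chart (geo_collapse tS)) -(chartK chart (geo_collapse tS')).
  by rewrite -[f (collapse t)]normalizeK -[f (collapse t')]normalizeK en eqe.
by rewrite -(collapseK t) -(collapseK t') ec eqh.
Qed.

Lemma new_chart_surj x : enorm x <= 1 -> exists2 t, geo (C |: S) t & new_chart t = x.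
Proof.
move=> x1; have r0 := radius_gt0 x.
have radZ c : 0 < c -> radius (c *: x) = radius x.
  by move=> c0; rewrite /radius normalizeZ.
have [le1|gt1] := leP (radius x * enorm x) 1.
  have le1' : enorm (radius x *: x) <= 1 by rewrite enormZ// ltW.
  have tS := chart_inv chart le1'.
  exists (g (radius x *: x)); first exact: geo_addr.
  rewrite /new_chart collapse_id// geo_height0// (chart_invK chart)//.
  by rewrite radZ// addr0 mul1r scalerA mulVf ?scale1r// gt_eqF.
have x0 : x != 0 by apply: contraTneq gt1 => ->; rewrite enorm0 mulr0 -leNgt ler01.
have n1 := enorm_normalize x0.
have n1' : enorm (normalize x) <= 1 by rewrite n1.
set s := g (normalize x); have sS : geo S s := chart_inv chart n1'.
have fs : f s = normalize x := chart_invK chart n1'.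
have sbd : geo bd s by apply/(chart_bd chart sS); rewrite fs.
(* Here [x] lies outside the shrunken old ball; [u] is its height over the boundary point [s], and
   [enorm x <= 1] bounds it by [q * depth s]. *)
pose u := radius x * enorm x - 1.
have u0 : 0 < u by rewrite subr_gt0.
have rx : radius x = 1 + q * depth s by [].
have ule : u <= q * depth s by rewrite /u rx in u0 *; have := enorm_ge0 x; nra.
have uled : u / q <= depth s by rewrite ler_pdivrMr// mulrC.
have d0 : 0 < depth s.
  by apply: lt_le_trans uled; rewrite divr_gt0.
have [P Pbd sP] := sbd.
(* Since [s] has positive depth, its boundary ridge contains [B]; then [bd_star] places [s] in [C],
   and the lift by [u] stays in [C]. *)
have [BP|/fintype.subsetPn[b bB bP]] := boolP (B \subset P); last first.
  by rewrite (depth_missing bB bP sP) ltxx in d0.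
have [a aA Pa] := bd_star Pbd BP; rewrite Pa in sP.
have hs := geo_height0 sS.
have ct : collapse (shift s u) = s.
  by rewrite /collapse height_shift hs add0r shiftD subrr shift0.
exists (shift s u).
  apply: geo_addl; have [s0 s1 sC] := sP; split.
  - move=> w; have [wC|wC] := boolP (w \in C); last by rewrite bary_shiftN.
    have [wA|wA] := boolP (w \in A); first by rewrite bary_shiftA// addr_ge0// ltW.
    have wB : w \in B by rewrite inE wA.
    by rewrite bary_shiftB// subr_ge0 (le_trans uled)// bmin_le.
  - by rewrite sum_shift.
  - by move=> w wC; rewrite bary_shiftN// sC// !inE (negbTE wC) andbF.
rewrite /new_chart ct height_shift hs add0r fs.
have -> : radius (normalize x) = radius x by rewrite radZ// invr_gt0 enorm_gt0.
have -> : 1 + u = radius x * enorm x by rewrite /u; lra.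
by rewrite mulrAC divff ?gt_eqF// mul1r normalizeK.
Qed.

Lemma cont_on_height (D : set V) : cont_on D height. Proof. exact: cont_on_bmin. Qed.

Lemma cont_on_collapse (D : set V) : cont_on D collapse.
Proof.
apply: cont_on_of_bary => w; apply: cont_onD; first exact: cont_on_bary.
apply: cont_onM; last exact: cont_on_cst.
by apply: cont_onN; apply: cont_on_height.
Qed.

(** The scaling factor may jump where [f (collapse t)] vanishes, because [normalize] may jump at 0.
    It is bounded by 2, as the height is at most 1 and the radius at least 1, so
    [cont_on_mul_vanishing] applies to each coordinate. *)
Lemma cont_new_chart : cont_on (geo (C |: S)) new_chart.
Proof.
apply: cont_on_row => i.
apply: (@eq_cont_on _ _ _ (fun t => f (collapse t) ord0 i *
    ((1 + height t) / radius (f (collapse t))))).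
  by move=> t _; rewrite mxE mulrC.
have cfc : cont_on (geo (C |: S)) (fun t => f (collapse t)).
  apply: cont_on_comp (cont_chart chart); first exact: geo_collapse.
  exact: cont_on_collapse.
apply: (@cont_on_mul_vanishing _ _ _ 2).
- apply: (@cont_on_comp _ _ _ _ setT _ (fun x : 'rV[R]_n => x ord0 i)) => //.
  exact: cont_on_coord.
- move=> t tS _; have [D tD] := geo_add_simplex tS.
  rewrite ger0_norm; last by apply: ltW; apply: scale_gt0.
  have r1 := radius_ge1 (f (collapse t)); have h1 := height_le1 tD.
  by rewrite ler_pdivrMr ?radius_gt0//; lra.
apply: cont_onM.
  by apply: cont_onD; [apply: cont_on_cst|apply: cont_on_height].
apply: cont_onV; first by move=> t _; rewrite gt_eqF ?radius_gt0.
apply: cont_onD; first exact: cont_on_cst.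
apply: cont_onM; first exact: cont_on_cst.
apply: (@cont_on_comp _ _ _ _ (geo S) _ depth); last exact: cont_on_bmin.
  by move=> t _; apply: (chart_inv chart); apply: enorm_normalize_le1.
apply: (@cont_on_comp _ _ _ _ [set x | enorm x <= 1]%classic
  (fun t => normalize (f (collapse t)))).
- by move=> t _; apply: enorm_normalize_le1.
- apply: (@cont_on_comp _ _ _ _ [set x : 'rV[R]_n | x != 0]%classic
    (fun t => f (collapse t)) (@normalize R n)).
  + by move=> t [_]; apply: contraNneq => ->; rewrite mxE.
  + by apply: cont_on_sub cfc => t [].
  + exact: cont_on_normalize.
- exact: (cont_chart_inv chart).
Qed.

Lemma ball_chart_add : exists f' g', @ball_chart R W n (C |: S) bd' f' g'.
Proof.
exists new_chart; apply: ball_chart_of_bij.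
- exact: cont_new_chart.
- by move=> t /new_chart_spec[].
- exact: new_chart_inj.
- exact: new_chart_surj.
- by move=> t /new_chart_spec[].
Qed.

End BallStep.

(** * The simplex as a ball *)

Section Cone.
Variables (R : realType) (W : finType) (C : {set W}) (c0 : W).
Hypothesis c0C : c0 \in C.
Local Notation V := 'rV[R]_#|W|.
Implicit Types (t s : V) (p : W -> R) (D : {set W}).

Let k : R := #|C|%:R.

Let k_gt0 : 0 < k.
Proof. by rewrite ltr0n; apply/card_gt0P; exists c0. Qed.

(* A point [t] of the simplex [C] is [r] times a point of its boundary plus
   [1 - r] times the barycenter; [cone_radius] is [r] and [cone_base] is [r]
   times the boundary point. *)
Definition cone_min t := bmin c0 C (bary t).
Definition cone_radius t := 1 - k * cone_min t.
Definition cone_base t w := bary t w - cone_min t * (w \in C)%:R.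

Lemma cone_baseC t w : w \in C -> cone_base t w = bary t w - cone_min t.
Proof. by rewrite /cone_base => ->; rewrite mulr1. Qed.

Lemma cone_baseN D t w : C \subset D -> in_simplex D t -> w \notin D -> cone_base t w = 0.
Proof.
move=> CD [_ _ tD] wD; rewrite /cone_base tD// sub0r.
by rewrite (contraNF (fintype.subsetP CD w) wD) mulr0 oppr0.
Qed.

Lemma cone_min_ge0 D t : in_simplex D t -> 0 <= cone_min t.
Proof. by case=> t0 _ _; rewrite /cone_min; have [a _ <-] := bmin_attained c0C (bary t). Qed.

Lemma cone_base_ge0 D t w : in_simplex D t -> 0 <= cone_base t w.
Proof.
case=> t0 _ _; rewrite /cone_base.
have [wC|wC] := boolP (w \in C); last by rewrite mulr0 subr0.
by rewrite mulr1 subr_ge0 bmin_le.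
Qed.

Lemma cone_base0 t : exists2 c, c \in C & cone_base t c = 0.
Proof.
have [c cC tc] := bmin_attained c0C (bary t); exists c => //.
by rewrite cone_baseC// tc subrr.
Qed.

Lemma sum_cone_base D t : in_simplex D t -> \sum_w cone_base t w = cone_radius t.
Proof. by case=> _ t1 _; rewrite sumrB t1 -mulr_sumr sum_mem mulrC. Qed.

Lemma cone_radius_ge0 D t : in_simplex D t -> 0 <= cone_radius t.
Proof.
by move=> tD; rewrite -(sum_cone_base tD) sumr_ge0// => w _; apply: cone_base_ge0 tD.
Qed.

Lemma cone_radius_le1 D t : in_simplex D t -> cone_radius t <= 1.
Proof.
move=> tD; rewrite /cone_radius gerBl.
by apply: mulr_ge0; [apply: ltW|apply: cone_min_ge0 tD].
Qed.

Lemma cone_radius1 t : (cone_radius t = 1) <-> (cone_min t = 0).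
Proof.
rewrite /cone_radius; split=> [e|->]; last by rewrite mulr0 subr0.
have /eqP : k * cone_min t = 0 by lra.
by rewrite mulf_eq0 gt_eqF//= => /eqP.
Qed.

Lemma cone_radius0 D t w : in_simplex D t -> cone_radius t = 0 -> cone_base t w = 0.
Proof.
move=> tD; rewrite -(sum_cone_base tD) => /eqP; rewrite psumr_eq0.
  by move=> /allP/(_ w); rewrite mem_index_enum => /(_ isT)/eqP.
by move=> v _; apply: cone_base_ge0 tD.
Qed.

Lemma cone_inj t s : cone_radius t = cone_radius s -> cone_base t =1 cone_base s -> t = s.
Proof.
move=> er eb; have em : cone_min t = cone_min s.
  by apply: (mulfI (lt0r_neq0 k_gt0)); move: er; rewrite /cone_radius; lra.
apply: bary_inj => w; have := eb w; rewrite /cone_base em; exact: addIr.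
Qed.

(** Inverts the cone coordinates by adding the constant [(1 - r) / k] to [p] on [C]: the sum becomes
    1, and the constant is the minimum over [C] because [p] has minimum 0 there. *)
Lemma cone_point p (r : R) : (forall w, 0 <= p w) -> (forall w, w \notin C -> p w = 0) ->
  (exists2 c, c \in C & p c = 0) -> \sum_w p w = r -> r <= 1 ->
  exists t, [/\ in_simplex C t, cone_radius t = r & cone_base t =1 p].
Proof.
move=> p0 pC [c cC pc] pr r1.
pose t : V := of_bary (fun w => p w + (1 - r) / k * (w \in C)%:R); exists t.
have r0 : 0 <= (1 - r) / k by rewrite divr_ge0 ?subr_ge0// ltW.
have tm : cone_min t = (1 - r) / k.
  apply: bmin_unique => //.
    by move=> a aC; rewrite of_baryE aC mulr1 lerDr.
  by exists c; rewrite // of_baryE pc cC mulr1 add0r.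
split.
- split.
  + by move=> w; rewrite of_baryE addr_ge0// mulr_ge0.
  + under eq_bigr => w _ do rewrite of_baryE.
    by rewrite big_split /= -mulr_sumr sum_mem pr divfK ?gt_eqF//; lra.
  + by move=> w wC; rewrite of_baryE pC// (negbTE wC) mulr0 addr0.
- by rewrite /cone_radius tm mulrC divfK ?gt_eqF//; lra.
- by move=> w; rewrite /cone_base of_baryE tm addrK.
Qed.

Lemma cont_on_cone_min (D : set V) : cont_on D cone_min.
Proof. exact: cont_on_bmin. Qed.

Lemma cont_on_cone_radius (D : set V) : cont_on D cone_radius.
Proof.
apply: cont_onB; first exact: cont_on_cst.
by apply: cont_onM; [apply: cont_on_cst|apply: cont_on_cone_min].
Qed.

Lemma cont_on_cone_base (D : set V) w : cont_on D (fun t => cone_base t w).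
Proof.
apply: cont_onB; first exact: cont_on_bary.
by apply: cont_onM; [apply: cont_on_cone_min|apply: cont_on_cst].
Qed.

Section Boundary.
Variable bd : {set {set W}}.
Hypothesis bdP : forall P, P \in bd <-> exists2 c, c \in C & P = C :\ c.

Lemma cone_bd t : in_simplex C t -> geo bd t <-> cone_min t = 0.
Proof.
move=> tC; split=> [[P /bdP[c cC ->] [_ _ tP]]|m0].
  apply/eqP; rewrite eq_le (cone_min_ge0 tC) andbT.
  by rewrite -(tP c); [apply: bmin_le|rewrite !inE eqxx].
have [c cC tc] := bmin_attained c0C (bary t).
exists (C :\ c); first by apply/bdP; exists c.
have [t0 t1 tN] := tC; split=> // w; rewrite !inE negb_and negbK => /orP[/eqP ->|/tN//].
by rewrite tc.
Qed.

Lemma geo_bd_simplex t : geo bd t -> in_simplex C t.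
Proof. by move=> [P /bdP[c cC ->]]; apply: in_simplexS; apply: finset.subD1set. Qed.

End Boundary.
End Cone.

(** * Radial chart of a simplex *)

Section Simplex.
Variables (R : realType) (W : finType) (n : nat) (C : {set W}) (c0 : W).
Variables (bd : {set {set W}}) (e : 'I_n -> W).
Hypothesis c0C : c0 \in C.
Hypothesis bdP : forall P, P \in bd <-> exists2 c, c \in C & P = C :\ c.
Hypothesis e_inj : injective e.
Hypothesis eC : forall i, e i \in C :\ c0.
Hypothesis e_surj : forall w, w \in C :\ c0 -> exists i, w = e i.
Local Notation V := 'rV[R]_#|W|.
Implicit Types (t s : V).

Local Notation radius := (@cone_radius R W C c0).
Local Notation base := (@cone_base R W C c0).

(** Differences with the coordinate at [c0] remove the constant subtracted by [cone_base] and put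
    the barycenter of [C] at the origin. *)
Definition affine_coord t : 'rV[R]_n := \row_i (bary t (e i) - bary t c0).
(** The affine image of the simplex is rescaled along rays so that the norm becomes [cone_radius],
    which is 1 exactly on the boundary. *)
Definition simplex_chart t := radius t *: normalize (affine_coord t).

Let eC' i : e i \in C. Proof. by have := eC i; rewrite inE => /andP[]. Qed.

Lemma affine_coordE t i : affine_coord t ord0 i = base t (e i) - base t c0.
Proof. by rewrite mxE !cone_baseC// opprB addrA subrK. Qed.

(* Two points whose affine coordinates are positively proportional have
   proportional cone bases: these differ by a constant on [C], and both have
   minimum 0. *)
Lemma affine_coord_prop t s (a : R) : in_simplex C t -> in_simplex C s -> 0 <= a ->
  affine_coord t = a *: affine_coord s -> forall w, base t w = a * base s w.
Proof.
move=> tC sC a0 ea.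
pose d := base t c0 - a * base s c0.
have dE w : w \in C -> base t w = a * base s w + d.
  move=> wC; have [->|wc] := eqVneq w c0; first by rewrite /d; lra.
  have [i ->] : exists i, w = e i by apply: e_surj; rewrite !inE wc.
  have := congr1 (fun x : 'rV[R]_n => x ord0 i) ea.
  by rewrite /d [RHS]mxE !affine_coordE; lra.
have d0 : d = 0.
  apply/eqP; rewrite eq_le; apply/andP; split.
    have [c cC tc] := cone_base0 c0C t; have := dE c cC.
    have := mulr_ge0 a0 (cone_base_ge0 C c0 c sC); lra.
  have [c cC sc] := cone_base0 c0C s; have := dE c cC; rewrite sc.
  have := cone_base_ge0 C c0 c tC; lra.
move=> w; have [wC|wC] := boolP (w \in C); first by rewrite dE// d0 addr0.
by rewrite !(cone_baseN c0 (fintype.subxx C))// mulr0.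
Qed.

Lemma affine_coord_neq0 t : in_simplex C t -> radius t != 0 -> affine_coord t != 0.
Proof.
move=> tC; apply: contraNneq => a0.
rewrite -(sum_cone_base C c0 tC); apply/eqP; apply: big1 => w _.
by rewrite (@affine_coord_prop t t 0)// ?mul0r// a0 scaler0.
Qed.

Lemma enorm_simplex_chart t : in_simplex C t -> enorm (simplex_chart t) = radius t.
Proof.
move=> tC; rewrite enormZ ?(cone_radius_ge0 C c0 tC)//.
have [->|r0] := eqVneq (radius t) 0; first by rewrite mul0r.
by rewrite enorm_normalize ?mulr1// affine_coord_neq0.
Qed.

Lemma simplex_chart_inj t s : in_simplex C t -> in_simplex C s ->
  simplex_chart t = simplex_chart s -> t = s.
Proof.
move=> tC sC ets.
have er : radius t = radius s by rewrite -!enorm_simplex_chart// ets.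
apply: (cone_inj c0C er) => w.
have [r0|r0] := eqVneq (radius t) 0.
  by rewrite (cone_radius0 w tC)// (cone_radius0 w sC)// -er.
have r0s : radius s != 0 by rewrite -er.
have rt0 : 0 < radius t by rewrite lt_def r0 (cone_radius_ge0 C c0 tC).
have en : normalize (affine_coord t) = normalize (affine_coord s).
  by move: ets; rewrite /simplex_chart -er => /(scalerI r0).
have yt := enorm_gt0 (affine_coord_neq0 tC r0).
have ys := enorm_gt0 (affine_coord_neq0 sC r0s).
(* Equal directions make the cone bases proportional with factor [a]; their sums are the equal
   radii, which forces [a = 1]. *)
pose a := enorm (affine_coord t) / enorm (affine_coord s).
have a0 : 0 <= a by rewrite divr_ge0// ltW.
have ea : affine_coord t = a *: affine_coord s.
  by rewrite -[LHS]normalizeK en /normalize scalerA.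
have bE := affine_coord_prop tC sC a0 ea.
have : radius t = a * radius s.
  rewrite -(sum_cone_base C c0 tC) -(sum_cone_base C c0 sC) mulr_sumr.
  by apply: eq_bigr => v _.
rewrite bE -er => ra; have -> : a = 1; last by rewrite mul1r.
by apply: (mulIf r0); rewrite mul1r.
Qed.

Lemma simplex_chart_surj x : enorm x <= 1 -> exists2 t, in_simplex C t & simplex_chart t = x.
Proof.
(* [p] extends [x] by 0 at [c0]; subtracting its minimum over [C] gives [p'], the cone base sought
   up to the factor [a] that makes the sum [enorm x]. *)
move=> x1; pose p w := \sum_i x ord0 i * (w == e i)%:R.
pose m := bmin c0 C p; pose p' w := (p w - m) * (w \in C)%:R.
have pe i : p (e i) = x ord0 i.
  rewrite /p (bigD1 i)//= eqxx mulr1 big1 ?addr0// => j ji.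
  by rewrite (inj_eq e_inj) eq_sym (negbTE ji) mulr0.
have pc0 : p c0 = 0.
  rewrite /p big1// => i _; have := eC i; rewrite !inE eq_sym => /andP[/negbTE-> _].
  by rewrite mulr0.
have p'0 w : 0 <= p' w.
  rewrite /p'; have [wC|_] := boolP (w \in C); last by rewrite mulr0.
  by rewrite mulr1 subr_ge0; apply: bmin_le.
pose sg := \sum_w p' w.
have sg0 : 0 <= sg by apply: sumr_ge0.
(* A zero sum would make [p] constant on [C], hence 0 there because [p c0 = 0]. *)
have sg_neq0 : x != 0 -> sg != 0.
  apply: contraNneq => /eqP; rewrite psumr_eq0// => /allP z.
  have pm w : w \in C -> p w = m.
    move=> wC; have := z w; rewrite mem_index_enum => /(_ isT)/eqP.
    by rewrite /p' wC mulr1; lra.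
  by apply/eqP/rowP => i; rewrite mxE -pe pm// -(pm _ c0C) pc0.
pose a := enorm x / sg.
have a0 : 0 <= a by rewrite divr_ge0// enorm_ge0.
have [t [tC rt bt]] : exists t, [/\ in_simplex C t, radius t = enorm x
    & base t =1 (fun w => a * p' w)].
  apply: cone_point => //.
  - by move=> w; rewrite mulr_ge0.
  - by move=> w wC; rewrite /p' (negbTE wC) !mulr0.
  - have [c cC pc] := bmin_attained c0C p; exists c => //.
    by rewrite /p' pc subrr mul0r mulr0.
  rewrite -mulr_sumr -/sg /a.
  have [->|/sg_neq0 x0] := eqVneq x 0; first by rewrite enorm0 !mul0r.
  by rewrite divfK.
exists t => //; rewrite /simplex_chart rt.
have ea : affine_coord t = a *: x.
  apply/rowP => i; rewrite affine_coordE !bt [RHS]mxE /p' eC' c0C pe pc0 !mulr1; lra.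
have [->|x0] := eqVneq x 0; first by rewrite enorm0 scale0r.
by rewrite ea normalizeZ ?normalizeK// divr_gt0 ?enorm_gt0// lt_def sg_neq0.
Qed.

Lemma ball_chart_simplex : exists f g, @ball_chart R W n [set C] bd f g.
Proof.
have geoC t : geo [set C] t <-> in_simplex C t.
  by split=> [[D]|tC]; [rewrite inE => /eqP ->|exists C; rewrite ?inE].
exists simplex_chart; apply: ball_chart_of_bij.
- apply: cont_on_row => i.
  apply: (@eq_cont_on _ _ _ (fun t => radius t * normalize (affine_coord t) ord0 i)).
    by move=> t _; rewrite [RHS]mxE.
  apply: (@cont_on_mul_vanishing _ _ _ 1); first exact: cont_on_cone_radius.
    move=> t _ _; apply: le_trans (le_coord_enorm _ _) (enorm_normalize_le1 _).
  apply: (@cont_on_comp _ _ _ _ setT _ (fun x : 'rV[R]_n => x ord0 i)) => //; last exact: cont_on_coord.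
  apply: (@cont_on_comp _ _ _ _ [set x : 'rV[R]_n | x != 0]%classic
    affine_coord (@normalize R n)).
  + by move=> t [/geoC tC]; apply: affine_coord_neq0.
  + apply: cont_on_row => j.
    apply: (@eq_cont_on _ _ _ (fun t => bary t (e j) - bary t c0)).
      by move=> t _; rewrite [RHS]mxE.
    by apply: cont_onB; apply: cont_on_bary.
  + exact: cont_on_normalize.
- by move=> t /geoC tC; rewrite enorm_simplex_chart// (cone_radius_le1 c0C tC).
- by move=> t s /geoC tC /geoC sC; apply: simplex_chart_inj.
- by move=> x /simplex_chart_surj[t tC <-]; exists t => //; apply/geoC.
- move=> t /geoC tC; rewrite enorm_simplex_chart//.
  by rewrite (cone_radius1 c0C) (cone_bd c0C bdP tC).
Qed.

End Simplex.

Lemma ball_chart1 (R : realType) (W : finType) (n : nat) (C : {set W}) (bd : {set {set W}}) :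
  #|C| = n.+1 -> (forall P, P \in bd <-> exists2 c, c \in C & P = C :\ c) ->
  exists f g, @ball_chart R W n [set C] bd f g.
Proof.
move=> Cn bdP; have /card_gt0P[c0 c0C] : (0 < #|C|)%N by rewrite Cn.
have C'n : #|C :\ c0| = n by have := cardsD1 c0 C; rewrite c0C Cn add1n => -[].
have sz : size (enum (C :\ c0)) = n by rewrite -cardE.
apply: (@ball_chart_simplex R W n C c0 bd (fun i => nth c0 (enum (C :\ c0)) i)) => //.
- move=> i j /eqP; rewrite nth_uniq ?sz ?ltn_ord// ?enum_uniq// => /eqP.
  exact: val_inj.
- by move=> i; rewrite -mem_enum mem_nth ?sz.
- move=> w; rewrite -mem_enum => wC.
  have lt : (index w (enum (C :\ c0)) < n)%N by rewrite -sz index_mem.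
  by exists (Ordinal lt); rewrite /= nth_index.
Qed.

(** * Attaching a simplex along its whole boundary *)

Section SphereStep.
Variables (R : realType) (W : finType) (n : nat).
Variables (S bd : {set {set W}}) (C : {set W}) (c0 : W).
Variables (f : 'rV[R]_#|W| -> 'rV[R]_n) (g : 'rV[R]_n -> 'rV[R]_#|W|).
Local Notation V := 'rV[R]_#|W|.
Implicit Types (t s : V) (D : {set W}).

Hypothesis chart : ball_chart S bd f g.
Hypothesis c0C : c0 \in C.
Hypothesis C_new : forall D, D \in S -> ~~ (C \subset D).
Hypothesis bdP : forall P, P \in bd <-> exists2 c, c \in C & P = C :\ c.
Hypothesis bd_faces : forall P, P \in bd -> exists2 D, D \in S & P \subset D.

Local Notation radius := (@cone_radius R W C c0).
Local Notation base := (@cone_base R W C c0).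

(** Radial projection of [C] from its barycenter to its boundary, and the identity on the old
    complex. At the barycenter the value is meaningless, but [sphere_chart] multiplies what depends
    on it by the radius 0. *)
Definition cone_proj t : V := of_bary (fun w => base t w / radius t).

(** One formula for two hemispheres. On the old ball the radius is 1 and the first coordinate is
    [- Num.sqrt (1 - enorm (f t) ^+ 2)]; on [C] away from the barycenter the projection has image of
    norm 1, which leaves [Num.sqrt (1 - radius t ^+ 2)]. *)
Definition sphere_chart t : 'rV[R]_n.+1 :=
  row_mx (Num.sqrt (1 - radius t ^+ 2)
           - radius t * Num.sqrt (1 - enorm (f (cone_proj t)) ^+ 2))%:M
         (radius t *: f (cone_proj t)).

Lemma geo_radius1 t : geo S t -> radius t = 1.
Proof.
move=> [D DS tD]; apply/(cone_radius1 c0C)/eqP.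
rewrite eq_le (cone_min_ge0 c0C tD) andbT.
have /fintype.subsetPn[c cC cD] := C_new DS.
by have [_ _ /(_ c cD)<-] := tD; apply: bmin_le.
Qed.

Lemma cone_proj_id t : radius t = 1 -> cone_proj t = t.
Proof.
move=> r1; have /(cone_radius1 c0C) m0 := r1.
by apply: bary_inj => w; rewrite of_baryE r1 invr1 mulr1 /cone_base m0 mul0r subr0.
Qed.

Lemma cone_proj_bd t : in_simplex C t -> radius t != 0 -> geo bd (cone_proj t).
Proof.
move=> tC r0; have rt0 : 0 < radius t by rewrite lt_def r0 (cone_radius_ge0 C c0 tC).
have [c cC tc] := cone_base0 c0C t.
exists (C :\ c); first by apply/bdP; exists c.
split.
- by move=> w; rewrite of_baryE divr_ge0 ?(cone_base_ge0 C c0 w tC)// ltW.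
- under eq_bigr => w _ do rewrite of_baryE.
  by rewrite -mulr_suml (sum_cone_base C c0 tC) divff.
- move=> w; rewrite of_baryE !inE negb_and negbK => /orP[/eqP ->|wC].
    by rewrite tc mul0r.
  by rewrite (cone_baseN c0 (fintype.subxx C) tC wC) mul0r.
Qed.

Lemma geo_cone_proj t : geo (C |: S) t -> radius t != 0 -> geo S (cone_proj t).
Proof.
move=> /geo_addP[tC r0|tS _]; first exact/(geo_bdW bd_faces)/cone_proj_bd.
by rewrite cone_proj_id ?geo_radius1.
Qed.

Lemma sphere_chart_old t : geo S t ->
  sphere_chart t = row_mx (- Num.sqrt (1 - enorm (f t) ^+ 2))%:M (f t).
Proof.
move=> tS; rewrite /sphere_chart cone_proj_id ?geo_radius1// scale1r expr1n subrr.
by rewrite sqrtr0 sub0r mul1r.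
Qed.

Lemma sphere_chart_new t : in_simplex C t ->
  sphere_chart t = row_mx (Num.sqrt (1 - radius t ^+ 2))%:M (radius t *: f (cone_proj t)) /\
  enorm (radius t *: f (cone_proj t)) = radius t.
Proof.
move=> tC; rewrite enormZ ?(cone_radius_ge0 C c0 tC)//.
rewrite /sphere_chart; have [->|r0] := eqVneq (radius t) 0.
  by rewrite !mul0r subr0.
have /= pb := cone_proj_bd tC r0.
have /(chart_bd chart (geo_bdW bd_faces pb)) -> := pb.
by rewrite expr1n subrr sqrtr0 mulr0 subr0 mulr1.
Qed.

Lemma enorm_row_mx (z : R) (x : 'rV[R]_n) :
  enorm (row_mx z%:M x : 'rV[R]_(1 + n)) ^+ 2 = z ^+ 2 + enorm x ^+ 2.
Proof.
rewrite !sqr_enorm big_split_ord /= big_ord1; congr (_ + _).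
  by rewrite row_mxEl mxE eqxx mulr1n.
by apply: eq_bigr => i _; rewrite row_mxEr.
Qed.

Lemma sphere_chart_norm t : geo (C |: S) t -> enorm (sphere_chart t) = 1.
Proof.
move=> tS; apply/eqP; rewrite -sqrp_eq1 ?enorm_ge0//; apply/eqP.
have [tC|{}tS] := geo_addP tS.
  have [-> e] := sphere_chart_new tC; rewrite enorm_row_mx e sqr_sqrtr ?subrK//.
  rewrite subr_ge0 expr_le1//; first exact: cone_radius_le1 tC.
  exact: cone_radius_ge0 tC.
rewrite sphere_chart_old// enorm_row_mx sqrrN sqr_sqrtr ?subrK//.
by rewrite subr_ge0 expr_le1// ?enorm_ge0// (chart_le1 chart).
Qed.

Lemma row_mx_inj (z z' : R) (x x' : 'rV[R]_n) :
  row_mx z%:M x = row_mx z'%:M x' -> z = z' /\ x = x'.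
Proof.
move=> /eq_row_mx[ez ex]; split=> //.
by have := congr1 (fun M : 'M[R]_1 => M ord0 ord0) ez; rewrite !mxE.
Qed.

Lemma row_mx_ord0 (z : R) (x : 'rV[R]_n) : (row_mx z%:M x : 'rV[R]_n.+1) ord0 ord0 = z.
Proof. by rewrite mxE; case: splitP => // j _; rewrite !ord1 mxE eqxx. Qed.

(** On [C] the first coordinate is nonpositive only at radius 1, that is, on the boundary of [C].
    This settles injectivity across the two hemispheres. *)
Lemma sphere_chart_upper t : in_simplex C t -> sphere_chart t ord0 ord0 <= 0 -> geo S t.
Proof.
move=> tC; have [-> _] := sphere_chart_new tC.
rewrite row_mx_ord0 => le0.
have r0 := cone_radius_ge0 C c0 tC; have r1 := cone_radius_le1 c0C tC.
have /eqP : Num.sqrt (1 - radius t ^+ 2) = 0.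
  by apply/eqP; rewrite eq_le le0 sqrtr_ge0.
rewrite sqrtr_eq0 subr_le0 => r1'.
have re : radius t = 1 by nra.
by apply: (geo_bdW bd_faces); apply/(cone_bd c0C bdP tC)/(cone_radius1 c0C).
Qed.

Lemma sphere_chart_lower t : geo S t -> sphere_chart t ord0 ord0 <= 0.
Proof.
move=> tS; rewrite sphere_chart_old//.
by rewrite row_mx_ord0 oppr_le0 sqrtr_ge0.
Qed.

Lemma sphere_chart_inj_new t s : in_simplex C t -> in_simplex C s ->
  sphere_chart t = sphere_chart s -> t = s.
Proof.
move=> tC sC; have [-> et] := sphere_chart_new tC; have [-> es] := sphere_chart_new sC.
move=> /row_mx_inj[_ ex].
have er : radius t = radius s by rewrite -et -es ex.
apply: (cone_inj c0C er) => w.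
have [r0|r0] := eqVneq (radius t) 0.
  by rewrite (cone_radius0 w tC)// (cone_radius0 w sC)// -er.
have r0s : radius s != 0 by rewrite -er.
have : cone_proj t = cone_proj s.
  rewrite -(chartK chart (geo_bdW bd_faces (cone_proj_bd tC r0))).
  rewrite -(chartK chart (geo_bdW bd_faces (cone_proj_bd sC r0s))).
  by move: ex; rewrite -er => /(scalerI r0) ->.
move=> /(congr1 (fun v => bary v w)); rewrite !of_baryE -er.
by apply: mulIf; rewrite invr_neq0.
Qed.

Lemma sphere_chart_inj t s : geo (C |: S) t -> geo (C |: S) s ->
  sphere_chart t = sphere_chart s -> t = s.
Proof.
have old v v' : geo S v -> geo S v' -> sphere_chart v = sphere_chart v' -> v = v'.
  move=> vS vS'; rewrite !sphere_chart_old// => /row_mx_inj[_ e].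
  by rewrite -(chartK chart vS) e (chartK chart).
move=> /geo_addP[tC|tS] /geo_addP[sC|sS] e.
- exact: sphere_chart_inj_new.
- by apply: old => //; apply: sphere_chart_upper => //; rewrite e sphere_chart_lower.
- by apply: old => //; apply: sphere_chart_upper => //; rewrite -e sphere_chart_lower.
- exact: old.
Qed.

Lemma sphere_chart_surj (y : 'rV[R]_n.+1) : enorm y = 1 ->
  exists2 t, geo (C |: S) t & sphere_chart t = y.
Proof.
pose y' : 'rV[R]_(1 + n) := y.
pose z := lsubmx y' ord0 ord0; pose x := rsubmx y'.
have yE : y = row_mx z%:M x.
  have -> : z%:M = lsubmx y' by apply/rowP => i; rewrite !ord1 [LHS]mxE eqxx mulr1n.
  by rewrite hsubmxK.
move=> y1; have : z ^+ 2 + enorm x ^+ 2 = 1 by rewrite -enorm_row_mx -yE y1 expr1n.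
rewrite yE; move: (z) (x) => {yE y y1 y'} {z} z {x} x zx1.
have x0 := enorm_ge0 x; have x1 : enorm x <= 1 by nra.
have z2 : 1 - enorm x ^+ 2 = z ^+ 2 by rewrite -zx1 addrK.
have [z0|z0] := leP z 0.
  have tS := chart_inv chart x1.
  exists (g x); first exact: geo_addr.
  by rewrite sphere_chart_old// (chart_invK chart)// z2 sqrtr_sqr ler0_norm// opprK.
(* For [z > 0] the preimage is the point of [C] of cone radius [enorm x] over the boundary point
   [s], or the barycenter if [x = 0]. *)
pose s := g (normalize x); pose p w := enorm x * bary s w.
have sS : geo S s by apply: (chart_inv chart); apply: enorm_normalize_le1.
have fs : f s = normalize x by apply: (chart_invK chart); apply: enorm_normalize_le1.
have sbd : x != 0 -> geo bd s.
  by move=> xn0; apply/(chart_bd chart sS); rewrite fs enorm_normalize.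
have [t [tC rt bt]] : exists t, [/\ in_simplex C t, radius t = enorm x & base t =1 p].
  have [D _ [s0 s1 sD]] := sS.
  apply: cone_point => //.
  - by move=> w; rewrite mulr_ge0.
  - move=> w wC; rewrite /p.
    have [->|/sbd/(geo_bd_simplex bdP)[_ _ ->]] := eqVneq x 0; rewrite ?mulr0//.
    by rewrite enorm0 mul0r.
  - have [xz|/sbd[P /bdP[c cC ->] [_ _ sc]]] := eqVneq x 0.
      by exists c0; rewrite // /p xz enorm0 mul0r.
    by exists c => //; rewrite /p sc ?mulr0// !inE eqxx.
  - by rewrite -mulr_sumr s1 mulr1.
exists t; first exact: geo_addl.
have [-> _] := sphere_chart_new tC; rewrite rt z2 sqrtr_sqr gtr0_norm//.
suff -> : enorm x *: f (cone_proj t) = x by [].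
have [->|xn0] := eqVneq x 0; first by rewrite enorm0 scale0r.
suff -> : cone_proj t = s by rewrite fs normalizeK.
apply: bary_inj => w; rewrite of_baryE bt rt /p mulrC mulKf//.
by rewrite gt_eqF// enorm_gt0.
Qed.

(** The projection is controlled only away from radius 0, but every term containing it is [radius t]
    times a factor bounded by 1. *)
Lemma cont_sphere_chart : cont_on (geo (C |: S)) sphere_chart.
Proof.
have cr (U : set V) : cont_on U radius by apply: cont_on_cone_radius.
have cfp : cont_on [set t | geo (C |: S) t /\ radius t != 0]%classic
    (fun t => f (cone_proj t)).
  apply: (@cont_on_comp _ _ _ _ (geo S)); last exact: (cont_chart chart).
    by move=> t []; apply: geo_cone_proj.
  apply: cont_on_of_bary => w; apply: cont_onM; first exact: cont_on_cone_base.
  by apply: cont_onV => // t [].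
have f1 t : geo (C |: S) t -> radius t != 0 -> enorm (f (cone_proj t)) <= 1.
  by move=> tS r0; apply: (chart_le1 chart); apply: geo_cone_proj.
apply: cont_on_row => i; case: (@split_ordP 1 n i) => j ->.
  apply: (@eq_cont_on _ _ _ (fun t => Num.sqrt (1 - radius t ^+ 2)
           - radius t * Num.sqrt (1 - enorm (f (cone_proj t)) ^+ 2))).
    by move=> t _; apply: esym; apply: etrans (row_mxEl _ _ _ _) _; rewrite !ord1 mxE eqxx.
  apply: cont_onB.
    apply: cont_on_sqrt; apply: cont_onB; first exact: cont_on_cst.
    by apply: cont_onM.
  apply: (@cont_on_mul_vanishing _ _ _ 1) => //.
    move=> t tS r0; rewrite ger0_norm ?sqrtr_ge0// -[X in _ <= X]sqrtr1 ler_wsqrtr//.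
    by rewrite gerBl sqr_ge0.
  apply: cont_on_sqrt; apply: cont_onB; first exact: cont_on_cst.
  have ce : cont_on [set t | geo (C |: S) t /\ radius t != 0]%classic
      (fun t => enorm (f (cone_proj t))).
    apply: (@cont_on_comp _ _ _ _ setT _ (@enorm R n)) => //; exact: cont_on_enorm.
  by apply: cont_onM.
apply: (@eq_cont_on _ _ _ (fun t => radius t * f (cone_proj t) ord0 j)).
  by move=> t _; apply: esym; apply: etrans (row_mxEr _ _ _ _) _; rewrite mxE.
apply: (@cont_on_mul_vanishing _ _ _ 1) => //.
  by move=> t tS r0; apply: le_trans (le_coord_enorm _ _) (f1 t tS r0).
apply: (@cont_on_comp _ _ _ _ setT _ (fun x : 'rV[R]_n => x ord0 j)) => //.
exact: cont_on_coord.
Qed.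

Lemma sphere_chart_homeo : homeomorphic (@geo R W (C |: S)) (unit_sphere R n.+1).
Proof.
have FB t : geo (C |: S) t -> unit_sphere R n.+1 (sphere_chart t).
  by move=> tS; apply/unit_sphereE; apply: sphere_chart_norm.
have Fsurj y : unit_sphere R n.+1 y -> exists2 t, geo (C |: S) t & sphere_chart t = y.
  by move=> /unit_sphereE; apply: sphere_chart_surj.
have [G [G1 G2 G3 G4]] := compact_inverse (@compact_geo R W (C |: S))
  cont_sphere_chart FB sphere_chart_inj Fsurj.
exists sphere_chart, G; split; first by split.
by split; apply/subspace_continuousP; [apply: cont_sphere_chart|].
Qed.

End SphereStep.

Lemma ball_chart_homeo (R : realType) (W : finType) n S bd f g :
  @ball_chart R W n S bd f g -> homeomorphic (@geo R W S) (closed_unit_ball R n).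
Proof.
move=> chart; exists f, g; split.
  split=> [t tS|x /closed_unit_ballE|t|x /closed_unit_ballE].
  - by apply/closed_unit_ballE; apply: (chart_le1 chart).
  - exact: (chart_inv chart).
  - exact: (chartK chart).
  - exact: (chart_invK chart).
split; apply/subspace_continuousP; first exact: (cont_chart chart).
by apply: cont_on_sub (cont_chart_inv chart) => x /closed_unit_ballE.
Qed.

(** * Mod 2 boundaries of shelling prefixes *)

Section Boundary.
Variables (W : finType) (n : nat).
Implicit Types (S : {set {set W}}) (C P G H A : {set W}) (z : pred {set W}).

(** The mod 2 boundary of the chain [S] of simplices with [n.+1] vertices: the [n]-element sets
    lying in an odd number of members. *)
Definition ridge_bd S : {set {set W}} :=
  [set P : {set W} | (#|P| == n) && \big[addb/false]_(B in S) (P \subset B)].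

Lemma big_addb_odd (I : finType) (D : {set I}) (p : pred I) :
  \big[addb/false]_(i in D) p i = odd #|[set i in D | p i]|.
Proof.
rewrite -sum1_card (big_morph odd oddD (erefl : odd 0 = false)).
rewrite [RHS]big_mkcond [LHS]big_mkcond; apply: eq_bigr => i _.
by rewrite inE; case: (i \in D); case: (p i).
Qed.

Lemma ridge_bd_face S P : P \in ridge_bd S -> exists2 B, B \in S & P \subset B.
Proof.
rewrite inE big_addb_odd => /andP[_]; case: (set_0Vmem [set B in S | P \subset B]).
  by move=> ->; rewrite cards0.
by move=> [B]; rewrite inE => /andP[BS PB] _; exists B.
Qed.

Lemma ridge_bd_add S C P : C \notin S ->
  (P \in ridge_bd (C |: S)) = (P \in ridge_bd [set C]) (+) (P \in ridge_bd S).
Proof. by move=> CS; rewrite !inE big_setU1// big_set1; case: (#|P| == n). Qed.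

Lemma ridge_bd1 C P : (P \in ridge_bd [set C]) = (#|P| == n) && (P \subset C).
Proof. by rewrite inE big_set1. Qed.

Lemma card_ridge C c : #|C| = n.+1 -> c \in C -> #|C :\ c| = n.
Proof. by move=> Cn cC; have := cardsD1 c C; rewrite cC Cn add1n => -[]. Qed.

Lemma ridge_bd1P C P : #|C| = n.+1 ->
  P \in ridge_bd [set C] <-> exists2 c, c \in C & P = C :\ c.
Proof.
move=> Cn; rewrite ridge_bd1; split=> [/andP[/eqP Pn PC]|[c cC ->]]; last first.
  by rewrite card_ridge// eqxx finset.subD1set.
have : #|C :\: P| == 1%N by rewrite cardsD (finset.setIidPr PC) Cn Pn subSnn.
move=> /cards1P[c Cc]; have : c \in C :\: P by rewrite Cc set11.
rewrite inE => /andP[cP cC]; exists c => //; apply/setP => w; rewrite !inE.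
have := finset.in_setD C P w; rewrite Cc inE => ->.
by have [/(fintype.subsetP PC)->|] := boolP (w \in P); rewrite ?andbF //=; case: (w \in C).
Qed.

Lemma subD1_mem C G c : G \subset C -> c \notin G -> G \subset C :\ c.
Proof. by move=> GC cG; rewrite subsetD1 GC. Qed.

Lemma ridge_pair C z v w : #|C| = n.+1 -> v \in C -> w \in C -> v != w ->
  (forall P, z P -> C :\ v :\ w \subset P -> exists2 c, c \in C & P = C :\ c) ->
  \big[addb/false]_(P : {set W} | C :\ v :\ w \subset P) z P = z (C :\ v) (+) z (C :\ w).
Proof.
move=> Cn vC wC vw zC; pose H := C :\ v :\ w.
have Hv : H \subset C :\ v by apply: finset.subD1set.
have Hw : H \subset C :\ w.
  by apply/fintype.subsetP => x; rewrite !inE => /and3P[-> _ ->].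
have vw' : C :\ w != C :\ v.
  by apply/eqP => /setP/(_ v); rewrite !inE eqxx vw vC.
rewrite (bigD1 (C :\ v))//= (bigD1 (C :\ w))/=; last by rewrite Hw vw'.
rewrite big1 ?addbF// => P /andP[/andP[HP Pv] Pw]; apply/negbTE/negP => zP.
have [c cC Pc] := zC P zP HP; move: HP Pv Pw; rewrite Pc => /fintype.subsetP/(_ c).
rewrite !inE eqxx cC andbT /=; have [->|cw] := eqVneq c w; first by rewrite eqxx.
by have [->|cv] := eqVneq c v; rewrite ?eqxx //= => /(_ isT).
Qed.

(* [z] is a mod 2 cycle of ridges relative to the star of [G]. *)
Definition cycle_at G z := forall H, #|H|.+1 = n -> G \subset H ->
  \big[addb/false]_(P : {set W} | H \subset P) z P = false.

(* The boundary complex has no proper nonempty mod 2 cycle in any link, as for a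
   triangulated sphere. *)
Definition sphere_like (bd : {set {set W}}) := forall G z,
  (forall P, z P -> (P \in bd) && (G \subset P)) -> cycle_at G z ->
  (forall P, z P = false) \/ (forall P, z P = (P \in bd) && (G \subset P)).

Lemma codim2P C H : #|C| = n.+1 -> #|H|.+1 = n -> H \subset C ->
  exists v w, [/\ v \in C, w \in C, v != w & H = C :\ v :\ w].
Proof.
move=> Cn Hn HC; have : (#|C :\: H| == 2)%N.
  by rewrite cardsD (finset.setIidPr HC) Cn -Hn -addn2 addKn.
move=> /cards2P[v [w [vw CH]]]; exists v, w.
have : (v \in C :\: H) && (w \in C :\: H) by rewrite CH !inE !eqxx orbT.
rewrite !inE => /andP[/andP[vH vC] /andP[wH wC]]; split=> //.
apply/setP => x; rewrite !inE.
have := finset.in_setD C H x; rewrite CH !inE.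
case: (boolP (x \in H)) => [xH _|_ /=].
  rewrite (fintype.subsetP HC)// andbT; apply/esym/andP; split.
    by apply: contraNneq wH => <-.
  by apply: contraNneq vH => <-.
by move=> <-; case: (x == v); case: (x == w).
Qed.

(** A face of [C] with two vertices fewer lies in exactly two ridges of [C]; a set not contained in
    [C] lies in none. *)
Lemma cycle_simplex C G : #|C| = n.+1 ->
  cycle_at G (fun P => (P \in ridge_bd [set C]) && (G \subset P)).
Proof.
move=> Cn H Hn GH.
have [HC|HC] := boolP (H \subset C); last first.
  rewrite big1// => P HP; rewrite ridge_bd1; apply/negbTE; apply: contra HC.
  by move=> /andP[/andP[_ PC] _]; apply: fintype.subset_trans PC.
have [v [w [vC wC vw He]]] := codim2P Cn Hn HC; rewrite He.
rewrite ridge_pair//; last by move=> P /andP[/(ridge_bd1P _ Cn)].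
have mem c : c \in C -> H \subset C :\ c ->
    (C :\ c \in ridge_bd [set C]) && (G \subset C :\ c).
  move=> cC Hc; apply/andP; split; last exact: fintype.subset_trans Hc.
  by apply/(ridge_bd1P _ Cn); exists c.
rewrite !mem// He; last exact: finset.subD1set.
by apply/fintype.subsetP => x; rewrite !inE => /and3P[-> _ ->].
Qed.

Lemma cycle_add G z z' : cycle_at G z -> cycle_at G z' ->
  cycle_at G (fun P => z P (+) z' P).
Proof. by move=> cz cz' H Hn GH; rewrite big_split /= cz// cz'. Qed.

(* Two ridges of [C] meet in a codimension 2 face whose only ridges in the
   support of [z] are these two. *)
Lemma cycle_exchange C G z b c : #|C| = n.+1 -> cycle_at G z ->
  b \in C -> c \in C -> G \subset C -> b \notin G -> c \notin G ->
  (forall P, z P -> C :\ b :\ c \subset P -> exists2 c, c \in C & P = C :\ c) ->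
  z (C :\ b) -> z (C :\ c).
Proof.
move=> Cn cz bC cC GC bG cG zC zb; have [<-//|bc] := eqVneq b c.
have Hn : #|C :\ b :\ c|.+1 = n.
  have := cardsD1 c (C :\ b); rewrite !inE cC eq_sym bc (card_ridge Cn bC) add1n.
  by move=> ->.
have GH : G \subset C :\ b :\ c by rewrite !subD1_mem.
by have := cz _ Hn GH; rewrite ridge_pair// zb; case: (z (C :\ c)).
Qed.

(** [cycle_exchange] carries one ridge of the cycle to every other ridge of [C] containing [G]. *)
Lemma sphere_like1 C : #|C| = n.+1 -> sphere_like (ridge_bd [set C]).
Proof.
move=> Cn G z zbd cz.
have [[P zP]|nz] := pselect (exists P, z P); last first.
  by left=> P; apply/negbTE/negP => zP; apply: nz; exists P.
right=> Q; apply/idP/idP => [/zbd//|].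
have /andP[/(ridge_bd1P _ Cn)[b bC Pb] GP] := zbd P zP.
move=> /andP[/(ridge_bd1P _ Cn)[c cC ->] GQ].
have := GP; rewrite Pb subsetD1 => /andP[GC bG].
have := GQ; rewrite subsetD1 => /andP[_ cG].
apply: (cycle_exchange Cn cz bC cC GC bG cG); last by rewrite -Pb.
by move=> P' /zbd/andP[/(ridge_bd1P _ Cn)].
Qed.

(** * The mod 2 boundary after attaching a simplex *)

Section Attach.
Variables (S : {set {set W}}) (C A : {set W}) (a0 : W).
Hypothesis Cn : #|C| = n.+1.
Hypothesis AC : A \subset C.
Hypothesis a0A : a0 \in A.
Hypothesis A_new : forall B, B \in S -> ~~ (A \subset B).
Hypothesis bd_attach : forall a, a \in A -> C :\ a \in ridge_bd S.

Lemma ridge_bd_new P : P \in ridge_bd S -> ~~ (A \subset P).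
Proof.
move=> /ridge_bd_face[B BS PB]; apply: contra (A_new BS) => AP.
exact: fintype.subset_trans PB.
Qed.

Lemma attach_notin : C \notin S.
Proof. by apply: contraL AC => /A_new. Qed.

(** The ridges [C :\ a] with [a] in [A] occur in both boundaries and cancel mod 2; the other ridges
    of [C] contain [A], so they are not old. *)
Lemma ridge_bd_addP P : P \in ridge_bd (C |: S) <->
  (P \in ridge_bd S /\ ~ exists2 a, a \in A & P = C :\ a) \/
  exists2 b, b \in C :\: A & P = C :\ b.
Proof.
have old c : c \in C -> (C :\ c \in ridge_bd S) = (c \in A).
  move=> cC; apply/idP/idP => [/ridge_bd_new|/bd_attach//].
  by apply: contraR => cA; rewrite subD1_mem.
rewrite ridge_bd_add ?attach_notin//; split.
  have [/(ridge_bd1P _ Cn)[c cC ->]|PC] := boolP (P \in ridge_bd [set C]).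
    by rewrite old// addTb => cA; right; exists c; rewrite // inE cA cC.
  rewrite addFb => PS; left; split=> // -[a aA Pa]; move/negP: PC; apply.
  by apply/(ridge_bd1P _ Cn); exists a => //; apply: (fintype.subsetP AC).
move=> [[PS nP]|[b]]; last first.
  rewrite inE => /andP[bA bC] ->; rewrite old// (negbTE bA) addbF.
  by apply/(ridge_bd1P _ Cn); exists b.
rewrite PS addbT; apply/negP => /(ridge_bd1P _ Cn)[c cC Pc].
by apply: nP; exists c => //; rewrite -old// -Pc.
Qed.

(** The ridges of [C] containing [C :\: A] form a nonempty mod 2 cycle inside the old boundary, so
    by [sphere_like] they are all its ridges containing [C :\: A]. This supplies [bd_star] in the
    geometric step. *)
Lemma attach_star P : sphere_like (ridge_bd S) -> P \in ridge_bd S ->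
  C :\: A \subset P -> exists2 a, a \in A & P = C :\ a.
Proof.
move=> sl PS BP.
have bdC Q : (Q \in ridge_bd [set C]) && (C :\: A \subset Q) ->
    exists2 a, a \in A & Q = C :\ a.
  move=> /andP[/(ridge_bd1P _ Cn)[c cC ->]]; rewrite subsetD1 inE cC andbT negbK.
  by move=> /andP[_ cA]; exists c.
case: (sl (C :\: A) (fun Q => (Q \in ridge_bd [set C]) && (C :\: A \subset Q))).
- by move=> Q QC; rewrite (andP QC).2 andbT; have [a aA ->] := bdC Q QC; apply: bd_attach.
- exact: cycle_simplex.
- move=> /(_ (C :\ a0)); rewrite (ridge_bd1 C) card_ridge ?(fintype.subsetP AC)//.
  by rewrite eqxx finset.subD1set subsetD1 finset.subsetDl inE a0A.
- by move=> zE; apply: bdC; rewrite zE PS BP.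
Qed.

(** A cycle without ridges of [C] is an old cycle. Otherwise exchange gives it all new ridges at
    [G], and adding the boundary of [C] mod 2 turns it into an old cycle. In both cases the
    invariant of the old boundary applies. *)
Lemma sphere_like_add : sphere_like (ridge_bd S) -> sphere_like (ridge_bd (C |: S)).
Proof.
move=> sl G z zbd cz.
have bdE P := ridge_bd_add P attach_notin.
have newN a : a \in A -> z (C :\ a) = false.
  move=> aA; apply/negbTE/negP => /zbd/andP[]; rewrite bdE bd_attach// addbT.
  move=> /negP[]; apply/(ridge_bd1P _ Cn); exists a => //.
  exact: (fintype.subsetP AC).
have AG P : A \subset G -> P \in ridge_bd S -> (G \subset P) = false.
  move=> AG /ridge_bd_new; apply: contraNF; exact: fintype.subset_trans.
have [[b bB zb]|nb] := pselect (exists2 b, b \in C :\: A & z (C :\ b)); last first.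
  have zS P : z P -> (P \in ridge_bd S) && (G \subset P).
    move=> zP; have /andP[/ridge_bd_addP[[-> _]|[b bB Pb]] -> //] := zbd P zP.
    by case: nb; exists b; rewrite -?Pb.
  have [z0|zE] := sl G z zS cz; [by left|].
  (* Here [z] is the whole old boundary at [G]. If [A \subset G], that is empty. Otherwise
     [G \subset C] would put [C :\ a] in [z], against [newN]; so no ridge of [C] contains [G], and
     the boundary at [G] is unchanged. *)
  have [/AG AG'|/fintype.subsetPn[a aA aG]] := boolP (A \subset G).
    left=> P; rewrite zE; apply/negbTE/negP => /andP[PS].
    by rewrite AG'.
  right=> P; rewrite zE bdE ridge_bd1.
  have [GP|] := boolP (G \subset P); rewrite ?andbF// !andbT.
  have [PC|] := boolP (P \subset C); rewrite ?andbF// andbT.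
  have GC := fintype.subset_trans GP PC.
  have : z (C :\ a) by rewrite zE bd_attach// subD1_mem.
  by rewrite newN.
have /andP[_] := zbd _ zb; rewrite subsetD1 => /andP[GC bG].
have [bA bC] : b \notin A /\ b \in C by move: bB; rewrite inE => /andP.
have zall c : c \in C -> c \notin A -> c \notin G -> z (C :\ c).
  move=> cC cA cG; apply: (cycle_exchange Cn cz bC cC GC bG cG) zb.
  (* An old ridge cannot contain [C :\ b :\ c], because that set contains [A]. *)
  move=> P /zbd/andP[/ridge_bd_addP[[/ridge_bd_new AP _]|[d dB ->]] _] HP.
    move/negP: AP; case; apply: fintype.subset_trans HP.
    by rewrite !subD1_mem.
  by exists d => //; move: dB; rewrite inE => /andP[].
pose z' P := z P (+) ((P \in ridge_bd [set C]) && (G \subset P)).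
have z'S P : z' P -> (P \in ridge_bd S) && (G \subset P).
  rewrite /z'; have [/(ridge_bd1P _ Cn)[c cC ->]|PC] := boolP (P \in ridge_bd [set C]).
    have [Gc|Gc] := boolP (G \subset C :\ c); last first.
      by rewrite addbF => /zbd/andP[_]; rewrite (negbTE Gc).
    have cG : c \notin G by move: Gc; rewrite subsetD1 => /andP[].
    have [cA|cA] := boolP (c \in A); first by rewrite bd_attach.
    by rewrite zall.
  by rewrite addbF => /zbd; rewrite bdE (negbTE PC).
have cz' : cycle_at G z' by apply: cycle_add => //; apply: cycle_simplex.
right=> P; have [z'0|z'E] := sl G z' z'S cz'; last first.
  have := z'E P; rewrite bdE /z'.
  by case: (z P); case: (P \in _); case: (P \in _); case: (G \subset P).
(* If [z'] is empty, [z] consists of the ridges of [C] at [G]. As [z] omits [C :\ a], this forces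
   [A \subset G], and the old boundary contributes nothing at [G]. *)
have [/AG AG'|/fintype.subsetPn[a aA aG]] := boolP (A \subset G); last first.
  have := z'0 (C :\ a); rewrite /z' newN// subD1_mem// andbT addFb => /negP[].
  apply/(ridge_bd1P _ Cn); exists a => //; exact: (fintype.subsetP AC).
have := z'0 P; rewrite bdE /z'; have [/AG'->|_] := boolP (P \in ridge_bd S).
  by rewrite !andbF addbF.
by rewrite addbF; case: (z P); case: (_ && _).
Qed.

End Attach.
End Boundary.

(** * Shellable thin complexes *)

Section Shelling.
Variables (R : realType) (W : finType) (K : scomplex W).

Lemma maximal_superset (A : {set {set W}}) (C : {set W}) :
  C \in A -> exists2 D, maximal_in A D & C \subset D.
Proof.
move=> CA; have [D /maxsetP[DA Dmax] CD] := maxset_exists (P := mem A) CA.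
exists D => //; apply/andP; split=> //; apply/forall_inP => B BA.
by apply/implyP => DB; apply/eqP; apply: Dmax.
Qed.

Lemma facet_face C : C \in facets K -> C \in faces K.
Proof. by rewrite inE => /andP[]. Qed.

Lemma face_sub_facet C : C \in faces K -> exists2 D, D \in facets K & C \subset D.
Proof. by move=> /maximal_superset[D DK CD]; exists D; rewrite // inE. Qed.

(** * Prefixes of a shelling *)

Section Prefixes.
Variables (n : nat) (s : seq {set W}).
Hypothesis facet_card : forall C, C \in facets K -> #|C| = n.+1.
Hypothesis thin : forall P : {set W}, #|P| = n ->
  (#|[set D in facets K | P \subset D]| <= 2)%N.
Hypothesis sh : is_shelling K s.

(** A maximal face of the attaching complex above [D] has codimension 1 in [C] by the shelling
    condition. *)
Lemma attaching_ridge s1 s2 C (D : {set W}) : s = s1 ++ C :: s2 -> s1 <> [::] ->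
  D \subset C -> has (fun B : {set W} => D \subset B) s1 ->
  exists c, [/\ c \in C, D \subset C :\ c & has (fun B : {set W} => C :\ c \subset B) s1].
Proof.
move=> es s1n DC Ds; have [_ sE satt] := sh.
have CF : C \in facets K by rewrite -sE es mem_cat inE eqxx orbT.
have DA : D \in attaching K s1 C.
  by rewrite inE DC Ds (faces_sub (facet_face CF) DC).
have [M Mmax DM] := maximal_superset DA.
have := satt _ _ _ es s1n M Mmax; rewrite /sdim (facet_card CF) => Mn.
have {}Mn : #|M| = n by move: Mn; rewrite -addn1 PoszD addrK => /(canRL (subrK _)); lia.
have /andP[] := Mmax; rewrite inE => /and3P[_ MC Ms] _.
have /(ridge_bd1P _ (facet_card CF))[c cC Mc] : M \in ridge_bd n [set C].
  by rewrite ridge_bd1 Mn eqxx.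
by exists c; rewrite -Mc.
Qed.

(** The ball case carries the combinatorial invariant along; in the sphere case the empty boundary
    prevents a further facet. [unit_sphere R n.+1] has dimension [n]. *)
Definition prefix_type (S : {set {set W}}) : Prop :=
  (exists f g, @ball_chart R W n S (ridge_bd n S) f g /\ sphere_like n (ridge_bd n S)) \/
  (homeomorphic (@geo R W S) (unit_sphere R n.+1) /\ ridge_bd n S = finset.set0).

Lemma shelling_prefix s1 s2 : s = s1 ++ s2 -> s1 <> [::] -> prefix_type [set B in s1].
Proof.
elim/last_ind: s1 s2 => [//|s1 C IH] s2; rewrite cat_rcons => es _.
have [sU sE _] := sh.
have CF : C \in facets K by rewrite -sE es mem_cat inE eqxx orbT.
have Cn := facet_card CF.
have -> : [set B in rcons s1 C] = C |: [set B in s1].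
  by apply/setP => B; rewrite !inE mem_rcons inE.
have [s10|/eqP s1n] := eqVneq s1 [::].
  have -> : C |: [set B in s1] = [set C].
    by apply/setP => B; rewrite s10 !inE orbF.
  left; have [f [g fg]] := @ball_chart1 R W n C _ Cn (fun P => ridge_bd1P P Cn).
  by exists f, g; split=> //; apply: sphere_like1.
(* [A] collects the vertices of [C] whose opposite ridge lies in an earlier facet. *)
set S := [set B in s1]; pose A := [set a in C | has (fun B : {set W} => C :\ a \subset B) s1].
have AC : A \subset C by apply/fintype.subsetP => a; rewrite inE => /andP[].
have att (D : {set W}) : D \subset C -> has (fun B : {set W} => D \subset B) s1 ->
    exists2 a, a \in A & D \subset C :\ a.
  move=> DC Ds; have [c [cC Dc cs]] := attaching_ridge es s1n DC Ds.
  by exists c => //; rewrite inE cC.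
(* The empty face is shared with any earlier facet, so [A] is nonempty. *)
have [a0 a0A _] : exists2 a, a \in A & finset.set0 \subset C :\ a.
  apply: att; rewrite ?finset.sub0set//.
  by case: (s1) s1n => //= B s1' _; rewrite finset.sub0set.
(* An old facet containing [A] would put [A] in the attaching complex, hence inside some [C :\ a]
   with [a] in [A]. *)
have A_new B : B \in S -> ~~ (A \subset B).
  rewrite inE => Bs; apply/negP => AB.
  have [|a aA] := att A AC; first by apply/hasP; exists B.
  by rewrite subsetD1 aA andbF.
have CS := attach_notin AC A_new.
have SF B : B \in S -> B \in facets K by rewrite inE -sE es mem_cat => ->.
(* [C] and some old facet contain this ridge; thinness leaves exactly one old facet, an odd
   number. *)
have bd_att a : a \in A -> C :\ a \in ridge_bd n S.
  rewrite inE => /andP[aC /hasP[B Bs CaB]].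
  rewrite inE (card_ridge Cn aC) eqxx big_addb_odd /=.
  set N := [set B in S | _].
  have : (#|C |: N| <= 2)%N.
    apply: leq_trans (thin (card_ridge Cn aC)); apply: subset_leq_card.
    apply/fintype.subsetP => D; rewrite !inE => /orP[/eqP ->|/andP[Ds ->]].
      by rewrite finset.subD1set andbT; move: CF; rewrite inE.
    by rewrite andbT; have := SF D; rewrite !inE => ->.
  have CN : C \notin N by rewrite inE (negbTE CS).
  have : (0 < #|N|)%N by apply/card_gt0P; exists B; rewrite !inE Bs.
  by rewrite cardsU1 CN; case: #|N| => [//|[]].
have bd_faces := @ridge_bd_face W n S.
(* The sphere case is impossible: its boundary is empty, yet contains [C :\ a0]. *)
have [[f [g [chart sl]]]|[_ bd0]] := IH _ es s1n; last first.
  by have := bd_att _ a0A; rewrite /S bd0 inE.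
have bdP := ridge_bd_addP Cn AC A_new bd_att.
have star P := attach_star (P := P) Cn AC a0A bd_att sl.
have [AeC|] := eqVneq A C; last first.
  rewrite finset.eqEsubset AC /= => /fintype.subsetPn[b0 b0C b0A].
  left; have b0B : b0 \in C :\: A by rewrite inE b0A.
  have [f' [g' fg']] := ball_chart_add chart a0A b0B AC A_new bd_faces bd_att star bdP.
  exists f', g'; split=> //.
  exact: (sphere_like_add Cn AC A_new bd_att sl).
have bdP' P : P \in ridge_bd n S <-> exists2 c, c \in C & P = C :\ c.
  split=> [PS|[c cC ->]]; last by apply: bd_att; rewrite AeC.
  have [|a aA ->] := star P PS; first by rewrite AeC finset.setDv finset.sub0set.
  by exists a; rewrite // -AeC.
right; split.
  have a0C := fintype.subsetP AC _ a0A.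
  apply: (sphere_chart_homeo chart a0C _ bdP' bd_faces) => B; rewrite -AeC; exact: A_new.
apply/setP => P; rewrite [RHS]inE; apply/negP => /bdP[[/bdP'[c cC Pc] nP]|[b]].
  by apply: nP; exists c; rewrite ?AeC.
by rewrite AeC finset.setDv inE.
Qed.

End Prefixes.

Lemma realizationE t : realization R K t <-> geo (facets K) t.
Proof.
rewrite /realization /= sum_bary; split=> [[t0 t1 tK]|[C CK [t0 t1 tC]]].
  have [C CF sC] := face_sub_facet tK; exists C => //; split=> // [w|w wC]; first exact: t0.
  apply/eqP; apply: contraNT wC => tw; apply: (fintype.subsetP sC).
  by rewrite inE.
split=> //; first by move=> i; have := t0 (enum_val i); rewrite /bary enum_valK.
apply: faces_sub (facet_face CK) _; apply/fintype.subsetP => w; rewrite inE.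
by apply: contraNT => /tC /eqP.
Qed.

Lemma shellable_ball_or_sphere : shellable K ->
  (forall C, C \in ridges K -> (#|[set D in facets K | C \subset D]| <= 2)%N) ->
  ball_or_sphere R K.
Proof.
move=> [pK [s sh]] thin.
have -> : ball_or_sphere R K = exists n : nat,
    homeomorphic (@geo R W (facets K)) (closed_unit_ball R n) \/
    homeomorphic (@geo R W (facets K)) (unit_sphere R n).
  rewrite /ball_or_sphere; have -> // : realization R K = geo (facets K).
  by apply/classical_sets.seteqP; split=> t /realizationE.
have [[C CF C0]|noC] := pselect (exists2 C, C \in facets K & C != finset.set0); last first.
  (* Without a nonempty facet the realization is empty, as is the unit sphere for [n = 0]. *)
  have emp t : ~ geo (facets K) t.
    move=> [C CF [_ t1 tC]]; have [C0|C0] := eqVneq C finset.set0.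
      move: t1; rewrite big1 => [/eqP|w _]; first by rewrite eq_sym oner_eq0.
      by apply: tC; rewrite C0 inE.
    by apply: noC; exists C.
  have emp' x : ~ unit_sphere R 0 x.
    by rewrite /unit_sphere /= big_ord0 => /eqP; rewrite eq_sym oner_eq0.
  exists 0%N; right; exists (fun=> 0), (fun=> 0); split.
    by split=> [t /emp|x /emp'|t /emp|x /emp'].
  by split; apply/subspace_continuousP; [move=> t /emp|move=> x /emp'].
have [n Cn] : exists n, #|C| = n.+1.
  by move: C0; rewrite -card_gt0; case: #|C| => // n _; exists n.
have facet_card D : D \in facets K -> #|D| = n.+1.
  by move=> DF; have := pK D C DF CF; rewrite /sdim Cn => /addIr[].
have dimK : scdim K = n%:Z.
  rewrite /scdim; have -> : \max_(D in faces K) #|D| = n.+1; last by rewrite -addn1 PoszD addrK.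
  apply/eqP; rewrite eqn_leq; apply/andP; split.
    apply/bigmax_leqP => D /face_sub_facet[B BF DB].
    by rewrite -(facet_card B BF) subset_leq_card.
  by rewrite -Cn; apply: (@leq_bigmax_cond _ _ (fun D : {set W} => #|D|)); apply: facet_face.
have thin' (P : {set W}) : #|P| = n -> (#|[set D in facets K | P \subset D]| <= 2)%N.
  move=> Pn; have [->|[D]] := set_0Vmem [set D in facets K | P \subset D].
    by rewrite cards0.
  rewrite !inE => /andP[DF PD]; apply: thin; rewrite inE; apply/andP; split.
    by apply: faces_sub PD; case/andP: DF.
  by rewrite /codim dimK /sdim Pn subKr.
have [_ sE _] := sh.
have -> : facets K = [set B in s] by apply/setP => B; rewrite -sE inE.
have s0 : s <> [::] by move=> s0; move: CF; rewrite -sE s0.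
have [[f [g [chart _]]]|[sph _]] :=
  shelling_prefix facet_card thin' sh (esym (cats0 s)) s0.
  by exists n; left; apply: ball_chart_homeo chart.
by exists n.+1; right.
Qed.

End Shelling.

(** * Tableau complexes *)

Section TableauComplex.
Variables (X Y : finType).
Implicit Types (E F G : {set X * Y}) (f : {ffun X -> Y}) (T : {set {ffun X -> Y}}).

Lemma tvertex_inj E : {in E &, injective (tvertex E)}.
Proof.
move=> p q pE qE /setP/(_ p); rewrite !inE eqxx pE !andbT /=.
by move=> /esym/negbT; rewrite negbK => /eqP.
Qed.

Lemma face_ofP E F p : p \in E -> (tvertex E p \in face_of E F) = (p \notin F).
Proof.
move=> pE; apply/imsetP/idP => [[q]|pF]; last by exists p; rewrite // inE pF.
by rewrite inE => /andP[qF qE] /(tvertex_inj pE qE) ->.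
Qed.

Lemma face_ofS E F G : F \subset E -> (face_of E G \subset face_of E F) = (F \subset G).
Proof.
move=> FE; apply/idP/idP => [s|FG]; last by apply: imsetS; apply: finset.setDS.
apply/fintype.subsetP => p pF; have pE := fintype.subsetP FE p pF.
apply: contraLR pF => pG; rewrite -(face_ofP F pE).
by apply: (fintype.subsetP s); rewrite face_ofP.
Qed.

Lemma card_face_of E F : F \subset E -> (#|face_of E F| + #|F|)%N = #|E|.
Proof.
move=> FE; rewrite card_in_imset => [|p q]; last first.
  by rewrite !inE => /andP[_ pE] /andP[_ qE]; apply: tvertex_inj.
by rewrite -(cardsID F E) (finset.setIidPr FE) addnC.
Qed.

Lemma card_sv_val F : #|F| = (\sum_x #|sv_val F x|)%N.
Proof.
rewrite -sum1_card (eq_bigl (fun p : X * Y => true && ((p.1, p.2) \in F))); last by case.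
rewrite -(pair_big_dep xpredT (fun x y => (x, y) \in F) (fun _ _ => 1%N)) /=.
by apply: eq_bigr => x _; rewrite sum1_card; apply: eq_card => y; rewrite !inE.
Qed.

Lemma tab_inE f F : tab_in f F = (graph f \subset F).
Proof.
apply/forallP/fintype.subsetP => [fF _ /imsetP[x _ ->]|fF x].
  by have := fF x; rewrite inE.
by rewrite inE; apply: fF; apply: imset_f.
Qed.

Lemma card_graph f : #|graph f| = #|X|.
Proof. by rewrite card_imset // => x y []. Qed.

Lemma sv_val_gt0 f F x : tab_in f F -> (0 < #|sv_val F x|)%N.
Proof. by move=> /forallP/(_ x) fF; apply/card_gt0P; exists (f x). Qed.

Section Facets.
Variables (T : {set {ffun X -> Y}}) (E : {set X * Y}).
Hypothesis hT : forall f, f \in T -> graph f \subset E.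
Local Notation Delta := (tableau_complex T E).

Lemma tc_facesP C :
  C \in faces Delta <-> exists F f, [/\ C = face_of E F, F \subset E, f \in T & graph f \subset F].
Proof.
split=> [/imsetP[F]|[F [f [-> FE fT fF]]]].
  rewrite inE => /andP[FE /exists_inP[f fT]]; rewrite tab_inE => fF ->.
  by exists F, f.
apply: imset_f; rewrite inE /sv_face FE; apply/exists_inP; exists f => //.
by rewrite tab_inE.
Qed.

(** Since [face_of] reverses inclusion, facets come from minimal set-valued tableaux. These are the
    graphs: all have size [#|X|], so none properly contains another. *)
Lemma tc_facets : facets Delta = [set face_of E (graph f) | f in T].
Proof.
have ff f : f \in T -> face_of E (graph f) \in faces Delta.
  by move=> fT; apply/tc_facesP; exists (graph f), f; rewrite hT.
apply/setP => C; rewrite inE; apply/andP/imsetP => [[/tc_facesP[F [f [-> FE fT fF]]]]|[f fT ->]].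
  move=> /forall_inP/(_ _ (ff f fT)); rewrite face_ofS ?hT// fF => /eqP <-.
  by exists f.
split; first exact: ff.
apply/forall_inP => D /tc_facesP[G [f' [-> GE f'T f'G]]]; apply/implyP.
rewrite face_ofS// => Gf; suff -> : G = graph f by [].
apply/eqP; rewrite eqEcard Gf card_graph -(card_graph f').
exact: subset_leq_card.
Qed.

Lemma card_tc_facet C : C \in facets Delta -> (#|C| + #|X|)%N = #|E|.
Proof.
by rewrite tc_facets => /imsetP[f fT ->]; rewrite -(card_graph f) card_face_of// hT.
Qed.

Lemma tc_pure : pure Delta.
Proof.
move=> C D /card_tc_facet CE /card_tc_facet DE; rewrite /sdim.
by congr (Posz _ - 1); apply/eqP; rewrite -(eqn_add2r #|X|) CE DE.
Qed.

Lemma tc_codim F : sv_face T E F ->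
  codim Delta (face_of E F) = \sum_(x : X) (#|sv_val F x|%:Z - 1).
Proof.
move=> /andP[FE /exists_inP[f fT fF]].
have fE : face_of E (graph f) \in facets Delta by rewrite tc_facets; apply: imset_f.
have mx : (\max_(C in faces Delta) #|C|)%N = #|face_of E (graph f)|.
  apply/eqP; rewrite eqn_leq; apply/andP; split.
    apply/bigmax_leqP => C /face_sub_facet[D DF CD].
    apply: leq_trans (subset_leq_card CD) _.
    by rewrite -(leq_add2r #|X|) !card_tc_facet.
  apply: (@leq_bigmax_cond _ _ (fun D : {set {set X * Y}} => #|D|)).
  exact: facet_face.
rewrite /codim /scdim /sdim mx sumrB -(big_morph Posz PoszD (erefl : Posz 0 = 0)).
rewrite -card_sv_val sumr_const.
have := card_tc_facet fE; have := card_face_of FE.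
have -> : 1 *+ #|[pred x : X | true]| = (#|X|)%:Z :> int.
  by rewrite -[RHS]natz; congr (_ *+ _); apply: eq_card.
lia.
Qed.

Lemma tc_ridge F : sv_face T E F ->
  face_of E F \in ridges Delta <->
  exists x : X, #|sv_val F x| = 2%N /\ forall x' : X, x' <> x -> #|sv_val F x'| = 1%N.
Proof.
move=> sF; have /andP[FE /exists_inP[f fT fF]] := sF.
have Fx x := sv_val_gt0 x fF.
have Ff : face_of E F \in faces Delta by apply: imset_f; rewrite inE.
rewrite inE Ff tc_codim// /=.
(* The terms are natural numbers because [F] contains a tableau; such a sum is 1 exactly when one
   term is 1 and the others are 0. *)
have -> : \sum_(x : X) (#|sv_val F x|%:Z - 1) = Posz (\sum_x (#|sv_val F x| - 1))%N.
  rewrite (big_morph Posz PoszD (erefl : Posz 0 = 0)).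
  by apply: eq_bigr => x _; have := Fx x; lia.
rewrite (_ : (1 : int) = Posz 1)// eqz_nat; split.
  move=> /sum_nat_eq1 [x [_ x1 x0]]; exists x; split.
    by have := Fx x; lia.
  by move=> x' /eqP xx'; have := Fx x'; have := x0 x' xx' isT; lia.
move=> [x [x2 x1]]; rewrite (bigD1 x)//= x2 big1// => x' /eqP /x1 ->.
by [].
Qed.

(** A tableau contained in [F] is determined by its value at the one point where [F] takes two
    values. *)
Lemma tc_thin C : C \in ridges Delta ->
  (#|[set D in facets Delta | C \subset D]| <= 2)%N.
Proof.
move=> CR; have := CR; rewrite inE => /andP[/imsetP[F]]; rewrite inE => sF CE _.
move: CR; rewrite CE => /(tc_ridge sF)[x [x2 x1]].
have [FE _] := andP sF.
apply: leq_trans (_ : #|[set f : {ffun X -> Y} | graph f \subset F]| <= 2)%N.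
  rewrite tc_facets.
  apply: leq_trans (leq_imset_card (fun f => face_of E (graph f)) _).
  apply: subset_leq_card; apply/fintype.subsetP => D; rewrite inE => /andP[/imsetP[f fT ->]].
  by rewrite face_ofS ?hT// => fF; apply: imset_f; rewrite inE.
rewrite -x2; have inj : {in [set f : {ffun X -> Y} | graph f \subset F] &,
    injective (fun f : {ffun X -> Y} => f x)}.
  move=> f f'; rewrite !inE -!tab_inE => /forallP fF /forallP f'F ff'.
  apply/ffunP => x'; have [->//|/eqP xx'] := eqVneq x' x.
  have /eqP/cards1P[y e] := x1 x' xx'.
  by have := fF x'; have := f'F x'; rewrite e !inE => /eqP -> /eqP.
rewrite -(card_in_imset inj); apply: subset_leq_card.
apply/fintype.subsetP => _ /imsetP[f fF ->]; move: fF; rewrite inE -tab_inE.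
by move=> /forallP.
Qed.

(* The link of the face [F] is the complex of the tableaux contained in [F],
   with [F] in place of [E]; on vertices the isomorphism is
   [E :\ p |-> F :\ p = (E :\ p) :&: F]. *)
Lemma tc_link C : C \in faces Delta -> iso_to_tableau_complex (link Delta C).
Proof.
move=> /tc_facesP[F [f0 [-> FE f0T f0F]]] {C}.
exists X, Y, [set f in T | graph f \subset F], F; split.
  by move=> f; rewrite inE => /andP[].
have vF p : p \in F -> tvertex E p :&: F = tvertex F p.
  by move=> pF; rewrite /tvertex finset.setIDAC (finset.setIidPr FE).
have grd : ground (link Delta (face_of E F)) = [set tvertex E p | p in F].
  apply/setP => v; rewrite inE; apply/andP/imsetP => [[vF' /imsetP[p pE vp]]|[p pF ->]].
    by exists p => //; rewrite vp face_ofP// negbK in vF'.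
  have pE := fintype.subsetP FE p pF.
  by rewrite face_ofP// pF; split=> //; apply: imset_f.
have im G : G \subset F ->
    [set v :&: F | v in [set tvertex E p | p in F :\: G]] = face_of F G.
  move=> GF; rewrite -imset_comp; apply: eq_in_imset => p.
  by rewrite inE => /andP[_ pF]; apply: vF.
have lf D : D \in faces (link Delta (face_of E F)) <->
    exists G f, [/\ G \subset F, f \in T, graph f \subset G
      & D = [set tvertex E p | p in F :\: G]].
  rewrite inE; split.
    move=> /and3P[/tc_facesP[H [_ [-> HE _ _]]] dis /tc_facesP[G [f [e GE fT fG]]]].
    (* Disjointness from the face of [F] puts every point of [E] outside [H] into [F]; the union of
       the two faces is then the face of [G = H :&: F]. *)
    have HF p : p \in E -> p \notin H -> p \in F.
      move=> pE pH; apply: contraTT dis => pF; apply/pred0Pn; exists (tvertex E p).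
      by rewrite /= !face_ofP// pH.
    have Gp p : p \in E -> (p \in G) = (p \in H) && (p \in F).
      move=> pE; have := face_ofP G pE; rewrite -e inE !face_ofP//.
      by case: (p \in G); case: (p \in H); case: (p \in F).
    exists G, f; split=> //.
      by apply/fintype.subsetP => p pG; move: (pG); rewrite Gp ?(fintype.subsetP GE)// => /andP[].
    apply/setP => v; apply/imsetP/imsetP => -[p]; rewrite inE => /andP[pH pE] ->; exists p => //.
      by rewrite inE Gp// (negbTE pH) HF.
    have {}pE' := fintype.subsetP FE p pE.
    by rewrite inE pE' andbT; move: pH; rewrite Gp// pE andbT.
  move=> [G [f [GF fT fG ->]]].
  have GE := fintype.subset_trans GF FE.
  have DE : [set tvertex E p | p in F :\: G] :|: face_of E F = face_of E G.
    apply/setP => v; rewrite inE; apply/orP/imsetP.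
      move=> [|] /imsetP[p]; rewrite inE => /andP[pn pE] ->; exists p => //; rewrite inE.
        by rewrite pn (fintype.subsetP FE).
      by rewrite pE andbT; apply: contra pn; apply: (fintype.subsetP GF).
    move=> [p]; rewrite inE => /andP[pG pE] ->; have [pF|pF] := boolP (p \in F).
      by left; apply: imset_f; rewrite inE pG.
    by right; rewrite face_ofP.
  have GK : face_of E G \in faces Delta by apply/tc_facesP; exists G, f.
  apply/and3P; split; last by rewrite DE.
    by apply: faces_sub GK _; rewrite -DE finset.subsetUl.
  rewrite -setI_eq0; apply/eqP/setP => v; rewrite !inE; apply/negP => /andP[/imsetP[p]].
  rewrite inE => /andP[pG pF] ->; rewrite face_ofP ?pF//.
  exact: (fintype.subsetP FE).
exists (fun v => v :&: F); split.
- rewrite grd => _ _ /imsetP[p pF ->] /imsetP[q qF ->]; rewrite !vF//.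
  by move=> /(tvertex_inj pF qF) ->.
- by rewrite grd -imset_comp; apply: eq_in_imset => p pF; apply: vF.
apply/setP => D; apply/imsetP/idP => [[D' /lf[G [f [GF fT fG ->]]] ->]|].
  rewrite im//; apply: imset_f; rewrite inE /sv_face GF; apply/exists_inP.
  by exists f; rewrite ?tab_inE// inE fT (fintype.subset_trans fG).
move=> /imsetP[G]; rewrite inE => /andP[GF /exists_inP[f]].
rewrite inE tab_inE => /andP[fT _] fG ->.
exists [set tvertex E p | p in F :\: G]; last by rewrite im.
by apply/lf; exists G, f.
Qed.

End Facets.
End TableauComplex.

Theorem theorem1p1 (R : realType) (X Y : finType) (T : {set {ffun X -> Y}})
    (E : {set X * Y}) (hT : forall f : {ffun X -> Y}, f \in T -> graph f \subset E) :
  let Delta := tableau_complex T E in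
  (pure Delta /\
   facets Delta = [set face_of E (graph f) | f in T]%SET) /\
  ((forall F : {set X * Y}, sv_face T E F ->
      codim Delta (face_of E F) = \sum_(x : X) (#|sv_val F x|%:Z - 1)) /\
   (forall F : {set X * Y}, sv_face T E F ->
      (face_of E F \in ridges Delta <->
       exists x : X, #|sv_val F x| = 2%N /\
         forall x' : X, x' <> x -> #|sv_val F x'| = 1%N))) /\
  ((forall C : {set {set X * Y}}, C \in ridges Delta ->
      (#|[set D in facets Delta | C \subset D]%SET| <= 2)%N) /\
   (shellable Delta -> ball_or_sphere R Delta)) /\
  (forall C : {set {set X * Y}}, C \in faces Delta ->
     iso_to_tableau_complex (link Delta C)).
Proof.
split; first by split; [apply: tc_pure|apply: tc_facets].
split; first by split=> F; [apply: tc_codim|apply: tc_ridge].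
split; last by move=> C; apply: tc_link.
split=> [C|sh]; first exact: tc_thin.
by apply: shellable_ball_or_sphere sh _ => C; apply: tc_thin.
Qed.
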